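(* Let $\mathbb F$ be a field of characteristic $0$, $\mathcal A=M_m(\mathbb F)$, and let $r\in\mathcal R_{\mathbb F}(\underline z)$ be a noncommutative rational expression in $\underline z=\{z_1,\dots,z_g\}$ that is defined at some point in $\mathcal A^g$. Then there exists a nonempty Zariski open set $\mathcal O\subseteq\operatorname{dom}_m r$ such that for every $\underline p\in\mathcal O$, the expansion $S$ of $r$ about $\underline p$ admits a totally reduced representation. Furthermore, this representation can be obtained by applying the reduction procedure to the standard construction of a representation of $S$.
   Context: Rational expressions: $\mathcal R_{\mathbb F}(\underline z)$ is the set of syntactically valid combinations of noncommutative polynomials over $\mathbb F$ in $z_1,\dots,z_g$, operations $+,\cdot,{}^{-1}$ and parentheses. For $\underline a\in M_m(\mathbb F)^g$, $r(\underline a)$ is obtained by replacing $z_j$ by $a_j$ and $1$ by $I_m$; $\operatorname{dom}_m r\subseteq M_m(\mathbb F)^g$ is the set of $\underline a$ at which all inverses occurring in $r$ exist. Series: $\langle\underline x\rangle$ is the free monoid of words in freely noncommuting letters $\underline x=\{x_1,\dots,x_g\}$. $\mathcal A\langle\underline x\rangle=\mathcal A*_{\mathbb F}\mathbb F\langle\underline x\rangle$, and $\mathcal A\langle\!\langle\underline x\rangle\!\rangle$ is its $(\underline x)$-adic completion. For $w=w_1\cdots w_\ell$, $\mathcal A^w$ is the $\mathbb F$-span of all $a_0w_1a_1\cdots w_\ell a_\ell$, $a_i\in\mathcal A$; every series is uniquely $S=\sum_w[S,w]$ with $[S,w]\in\mathcal A^w$. A series is invertible iff $[S,1]$ is invertible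 in $\mathcal A$. For $\underline p\in\operatorname{dom}_m r$, the expansion of $r$ about $\underline p$ is the series $S=r(x_1+p_1,\dots,x_g+p_g)\in\mathcal A\langle\!\langle\underline x\rangle\!\rangle$. Representations: a representation of dimension $n$ of $S$ is $(\mathbf c,A,\mathbf b)$ with $\mathbf c\in\mathcal A^{1\times n}$, $\mathbf b\in\mathcal A^{n\times1}$, $A^x\in(\mathcal A^x)^{n\times n}$ ($x\in\underline x$) and $[S,w]=\mathbf cA^w\mathbf b$ for all words $w$, where $A^w=A^{w_1}\cdots A^{w_{|w|}}$. Only the zero series has a representation of dimension $0$. Its obstruction modules are $\mathcal U_\infty^L=\{\mathbf u\in\mathcal A^{1\times n}:\mathbf uA^w\mathbf b=0\ \forall w\}$ (left $\mathcal A$-module) and $\mathcal U_\infty^R=\{\mathbf v\in\mathcal A^{n\times1}:\mathbf cA^w\mathbf v=0\ \forall w\}$ (right $\mathcal A$-module). It is totally reduced if $\mathcal U_\infty^L=0$ and $\mathcal U_\infty^R=0$, and reduced if both are torsion (every element is annihilated by some nonzero element of $\mathcal A$). Standard construction: the representation of $S=r(\underline x+\underline p)$ built recursively along $r$ as follows. The constant $1$ has representation $(1,0,1)$ of dimension $1$; $x_i+a$ with $a\in\mathcal A$ has the representation $\left(\begin{pmatrix}1&a\end{pmatrix},A,\begin{pmatrix}0\\1\end{pmatrix}\right)$ of dimension $2$, where $A^{x_j}=\begin{pmatrix}0&\delta_{ij}x_j\\0&0\end{pmatrix}$; if $S$ has representation $(\mathbf c,A,\mathbf b)$ then $aS$ and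 $Sa$ have representations $(a\mathbf c,A,\mathbf b)$ and $(\mathbf c,A,\mathbf ba)$; if $S_i$ has representation $(\mathbf c_i,A_i,\mathbf b_i)$, then $S_1+S_2$ and $S_1S_2$ have the representations $$\left(\begin{pmatrix}\mathbf c_1&\mathbf c_2\end{pmatrix},\begin{pmatrix}A_1&0\\0&A_2\end{pmatrix},\begin{pmatrix}\mathbf b_1\\\mathbf b_2\end{pmatrix}\right),\quad\left(\begin{pmatrix}\mathbf c_1&\mathbf c_1\mathbf b_1\mathbf c_2\end{pmatrix},\begin{pmatrix}A_1&A_1\mathbf b_1\mathbf c_2\\0&A_2\end{pmatrix},\begin{pmatrix}0\\\mathbf b_2\end{pmatrix}\right),$$ and $S^{-1}$, with $a=[S,1]$, has the representation $$\left(\begin{pmatrix}-a^{-1}\mathbf c&a^{-1}\end{pmatrix},\begin{pmatrix}A(I-\mathbf ba^{-1}\mathbf c)&A\mathbf ba^{-1}\\0&0\end{pmatrix},\begin{pmatrix}0\\1\end{pmatrix}\right).$$ Reduction procedure: a left step applied to $(\mathbf c,A,\mathbf b)$ of dimension $n$: choose a maximal left $\mathcal A$-linearly independent set $\{\mathbf u_{k+1},\dots,\mathbf u_n\}\subset\mathcal U_\infty^L$, extend it to a basis $\{\mathbf u_1,\dots,\mathbf u_n\}$ of $\mathcal A^{1\times n}$, let $U$ be the matrix with rows $\mathbf u_i$, and replace $(\mathbf c,A,\mathbf b)$ by the representation of dimension $k$ consisting of the first $k$ entries of $\mathbf cU^{-1}$, the upper-left $k\times k$ block of $UAU^{-1}$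 and the first $k$ entries of $U\mathbf b$ (this again represents $S$). A right step is the mirror image, using a maximal right linearly independent subset of $\mathcal U_\infty^R$ extended to a basis of $\mathcal A^{n\times1}$. Starting with a left step, left and right steps are alternated until the resulting representation is reduced. *)

(* Defs.v *)
From HB Require Import structures.
From mathcomp Require Import all_boot all_order all_algebra.
From mathcomp Require Import boolp classical_sets.
From mathcomp.multinomials Require mpoly.

Set Implicit Arguments.
Unset Strict Implicit.
Unset Printing Implicit Defensive.

Import GRing.Theory.
Local Open Scope classical_set_scope.
Local Open Scope ring_scope.

(* Formal power series in noncommuting letters T that commute with their      *)
(* coefficients in A: a series is its coefficient function.                   *)
Definition ncseries (T : Type) (A : Type) : Type := seq T -> A.

Section NCSeries.
Variables (F : fieldType) (A : unitAlgType F) (T : Type).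
Notation series := (ncseries T A).
Implicit Types (S U V : series) (u : seq T).

HB.instance Definition _ := gen_eqMixin series.
HB.instance Definition _ := gen_choiceMixin series.

Definition ncs_add S U : series := fun u => S u + U u.
Definition ncs_opp S : series := fun u => - S u.
Definition ncs_zero : series := fun=> 0.
Definition ncs_cst (a : A) : series := fun u => if u is [::] then a else 0.
Definition ncs_mul S U : series :=
  fun u => \sum_(i < (size u).+1) S (take i u) * U (drop i u).
Definition ncs_scale (k : F) S : series := fun u => k *: S u.

Fact ncs_addA : associative ncs_add.
Proof. by move=> S U V; apply/funext => u; apply: addrA. Qed.
Fact ncs_addC : commutative ncs_add.
Proof. by move=> S U; apply/funext => u; apply: addrC. Qed.
Fact ncs_add0 : left_id ncs_zero ncs_add.
Proof. by move=> S; apply/funext => u; apply: add0r. Qed.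
Fact ncs_addN : left_inverse ncs_zero ncs_opp ncs_add.
Proof. by move=> S; apply/funext => u; apply: addNr. Qed.

HB.instance Definition _ :=
  GRing.isZmodule.Build series ncs_addA ncs_addC ncs_add0 ncs_addN.

Lemma ncs_addE S U u : (S + U) u = S u + U u. Proof. by []. Qed.
Lemma ncs_0E u : (0 : series) u = 0. Proof. by []. Qed.

Lemma ncs_mul_nil S U : ncs_mul S U [::] = S [::] * U [::].
Proof. by rewrite /ncs_mul big_ord1. Qed.

Lemma ncs_mul_cons S U t u :
  ncs_mul S U (t :: u) = S [::] * U (t :: u) + ncs_mul (fun v => S (t :: v)) U u.
Proof. by rewrite /ncs_mul big_ord_recl. Qed.

Fact ncs_mulDl : left_distributive ncs_mul +%R.
Proof.
move=> S U V; apply/funext => u; rewrite ncs_addE /ncs_mul -big_split /=.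
by apply: eq_bigr => i _; rewrite ncs_addE mulrDl.
Qed.

Fact ncs_mulDr : right_distributive ncs_mul +%R.
Proof.
move=> S U V; apply/funext => u; rewrite ncs_addE /ncs_mul -big_split /=.
by apply: eq_bigr => i _; rewrite ncs_addE mulrDr.
Qed.

Let ncs_mulCl (a : A) S U u :
  ncs_mul (fun v => a * S v) U u = a * ncs_mul S U u.
Proof. by rewrite /ncs_mul mulr_sumr; apply: eq_bigr => i _; rewrite mulrA. Qed.

Fact ncs_mulA : associative ncs_mul.
Proof.
move=> S U V; apply/funext => u; elim: u S U => [|t u IH] S U.
  by rewrite !ncs_mul_nil mulrA.
rewrite !ncs_mul_cons ncs_mul_nil IH mulrDr mulrA -addrA; congr (_ + _).
rewrite -ncs_mulCl -[LHS]/((ncs_mul _ V + ncs_mul _ V : series) u) -ncs_mulDl.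
by congr (ncs_mul _ V u); apply/funext => v; rewrite ncs_addE ncs_mul_cons.
Qed.

Lemma ncs_cst_mulE a S u : ncs_mul (ncs_cst a) S u = a * S u.
Proof.
case: u => [|t u]; first by rewrite ncs_mul_nil.
rewrite ncs_mul_cons /= /ncs_mul big1 ?addr0 // => i _.
by rewrite mul0r.
Qed.

Lemma ncs_mul_cstE S a u : ncs_mul S (ncs_cst a) u = S u * a.
Proof.
elim: u S => [|t u IH] S; first by rewrite ncs_mul_nil.
by rewrite ncs_mul_cons IH /= mulr0 add0r.
Qed.

Fact ncs_mul1 : left_id (ncs_cst 1) ncs_mul.
Proof. by move=> S; apply/funext => u; rewrite ncs_cst_mulE mul1r. Qed.
Fact ncs_1mul : right_id (ncs_cst 1) ncs_mul.
Proof. by move=> S; apply/funext => u; rewrite ncs_mul_cstE mulr1. Qed.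
Fact ncs_oner_neq0 : ncs_cst 1 != 0 :> series.
Proof.
by apply/eqP => /(congr1 (fun S : series => S [::])) /eqP; rewrite oner_eq0.
Qed.

HB.instance Definition _ := GRing.Zmodule_isNzRing.Build series
  ncs_mulA ncs_mul1 ncs_1mul ncs_mulDl ncs_mulDr ncs_oner_neq0.

Lemma ncs_mulE S U u :
  (S * U) u = \sum_(i < (size u).+1) S (take i u) * U (drop i u).
Proof. by []. Qed.

Fact ncs_scaleA (k l : F) S :
  ncs_scale k (ncs_scale l S) = ncs_scale (k * l) S.
Proof. by apply/funext => u; apply: scalerA. Qed.
Fact ncs_scale1 : left_id 1 ncs_scale.
Proof. by move=> S; apply/funext => u; apply: scale1r. Qed.
Fact ncs_scaleDr : right_distributive ncs_scale +%R.
Proof. by move=> k S U; apply/funext => u; apply: scalerDr. Qed.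
Fact ncs_scaleDl S : {morph ncs_scale^~ S : k l / k + l}.
Proof. by move=> k l; apply/funext => u; apply: scalerDl. Qed.

HB.instance Definition _ := GRing.Zmodule_isLmodule.Build F series
  ncs_scaleA ncs_scale1 ncs_scaleDr ncs_scaleDl.

Lemma ncs_scaleE (k : F) S u : (k *: S) u = k *: S u. Proof. by []. Qed.

Fact ncs_scaleAl (k : F) S U : k *: (S * U) = (k *: S) * U.
Proof.
apply/funext => u; rewrite ncs_scaleE !ncs_mulE scaler_sumr.
by apply: eq_bigr => i _; rewrite scalerAl.
Qed.
HB.instance Definition _ := GRing.Lmodule_isLalgebra.Build F series ncs_scaleAl.

Fact ncs_scaleAr (k : F) S U : k *: (S * U) = S * (k *: U).
Proof.
apply/funext => u; rewrite ncs_scaleE !ncs_mulE scaler_sumr.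
by apply: eq_bigr => i _; rewrite scalerAr.
Qed.
HB.instance Definition _ := GRing.Lalgebra_isAlgebra.Build F series ncs_scaleAr.

(* The inverse, computed by recursion on the length of the word (the nat      *)
(* argument is fuel).                                                         *)
Fixpoint ncs_inv_rec S (n : nat) u : A :=
  match n, u with
  | n'.+1, _ :: _ =>
      - ((S [::])^-1 * \sum_(i < size u)
           S (take i.+1 u) * ncs_inv_rec S n' (drop i.+1 u))
  | _, _ => (S [::])^-1
  end.

Definition ncs_unit : pred series := fun S => S [::] \is a GRing.unit.
Definition ncs_inv S : series :=
  if ncs_unit S then fun u => ncs_inv_rec S (size u) u else S.

Let ncs_inv_recE S n u : (size u <= n)%N ->
  ncs_inv_rec S n u = ncs_inv_rec S (size u) u.
Proof.
have [k] := ubnP (size u); elim: k n u => // k IH n [|t u] /= leuk leun.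
  by case: n leun.
case: n leun => // n leun; congr (- (_ * _)); apply: eq_bigr => i _.
have le1 : (size (drop i u) <= size u)%N by rewrite size_drop leq_subr.
have ltk : (size (drop i u) < k)%N by apply: leq_ltn_trans le1 leuk.
congr (_ * _); apply: (etrans (IH n (drop i u) ltk (leq_trans le1 leun))).
by apply: esym; apply: IH.
Qed.

Let ncs_divV S : ncs_unit S -> S * ncs_inv S = 1.
Proof.
move=> uS; apply/funext => -[|t u].
  by rewrite [LHS]ncs_mul_nil /ncs_inv uS /= divrr.
rewrite ncs_mulE big_ord_recl take0 drop0 /ncs_inv uS /= mulrN mulVKr //.
apply/eqP; rewrite addrC subr_eq0; apply/eqP; apply: eq_bigr => i _.
by rewrite [in RHS]ncs_inv_recE // size_drop leq_subr.
Qed.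

Fact ncs_divr : {in ncs_unit, right_inverse 1 ncs_inv *%R}.
Proof. by move=> S; apply: ncs_divV. Qed.

Fact ncs_mulVr : {in ncs_unit, left_inverse 1 ncs_inv *%R}.
Proof.
rewrite /prop_in1 => S; rewrite -topredE /= => uS.
have SV := ncs_divV uS; set V := ncs_inv S in SV *.
have uV : ncs_unit V.
  by rewrite /V /ncs_unit /ncs_inv uS /= unitrV.
by rewrite -[LHS]mulr1 -(ncs_divV uV) -mulrA (mulrA S) SV mul1r.
Qed.

Fact ncs_unitP S U : U * S = 1 /\ S * U = 1 -> ncs_unit S.
Proof.
case=> /(congr1 (fun V : series => V [::])) /= e1.
move=> /(congr1 (fun V : series => V [::])) /= e2.
apply/unitrP; exists (U [::]).
by rewrite -[LHS]ncs_mul_nil -[S _ * _]ncs_mul_nil.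
Qed.

Fact ncs_inv_out : {in [predC ncs_unit], ncs_inv =1 id}.
Proof. by move=> S nS; rewrite /ncs_inv [ncs_unit S](negbTE nS). Qed.

HB.instance Definition _ := GRing.NzRing_hasMulInverse.Build series
  ncs_mulVr ncs_divr ncs_unitP ncs_inv_out.

Lemma ncs_unitE S : (S \is a GRing.unit) = (S [::] \is a GRing.unit).
Proof. by []. Qed.

End NCSeries.

(* The completed free product A<<x>> = (A *_F F<x>)^ for A = M_m.+1(F).       *)
(* With E_ij the matrix units, the component A^w, w = w_1 ... w_l, has the    *)
(* F-basis E_{i_0 j_0} w_1 E_{i_1 j_1} ... w_l E_{i_l j_l}.  The coordinate   *)
(* of S along this vector is stored as entry (i_0, j_l) of the value of S at  *)
(* (w_1, (j_0, i_1)) ... (w_l, (j_{l-1}, i_l)); the product of A<<x>> then    *)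
(* becomes the product of ncseries.  See basis_monoE and spanwP below.        *)
Notation fpseries F m g :=
  (ncseries ('I_g * ('I_m.+1 * 'I_m.+1)) 'M[F]_m.+1).

Notation mxpoint F m g := ('I_g -> 'M[F]_m.+1).

Section FreeProduct.
Variables (F : fieldType) (m g : nat).
Notation A := 'M[F]_m.+1.
Notation series := (fpseries F m g).

Definition acst (a : A) : series := ncs_cst a.

Definition Xvar (k : 'I_g) : series :=
  fun u => if u is [:: (l, (i, j))] then (l == k)%:R *: delta_mx i j else 0.

(* a_0 w_1 a_1 ... w_l a_l, from a_0 and (w_1, a_1), ..., (w_l, a_l) *)
Fixpoint wmono (a0 : A) (s : seq ('I_g * A)) : series :=
  if s is (k, a) :: s' then acst a0 * Xvar k * wmono a s' else acst a0.

(* T \in A^w; scalars are absorbed in a_0, so sums suffice for the F-span *)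
Definition spanw (w : seq 'I_g) (T : series) : Prop :=
  exists2 L : seq (A * seq ('I_g * A)),
    all (fun t => unzip1 t.2 == w) L & T = \sum_(t <- L) wmono t.1 t.2.

(* [S, w] *)
Definition scomp (S : series) (w : seq 'I_g) : series :=
  fun u => if unzip1 u == w then S u else 0.

Lemma cstXE (a : A) k T u : (acst a * Xvar k * T) u =
  if u is (l, (i, j)) :: u' then (l == k)%:R *: (a * delta_mx i j * T u') else 0.
Proof.
rewrite -mulrA [LHS]ncs_cst_mulE; case: u => [|[l [i j]] u].
  by rewrite [(Xvar k * T) _]ncs_mul_nil mul0r mulr0.
rewrite [(Xvar k * T) _]ncs_mul_cons mul0r add0r.
have -> : (fun v => Xvar k ((l, (i, j)) :: v)) =
          acst ((l == k)%:R *: delta_mx i j) by apply/funext => -[].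
by rewrite ncs_cst_mulE -scalerAl scalerAr mulrA -!scalerAr.
Qed.

Fixpoint basis_mono (i : 'I_m.+1) (u : seq ('I_g * ('I_m.+1 * 'I_m.+1)))
    (j : 'I_m.+1) : series :=
  if u is (k, (h, i')) :: u'
  then acst (delta_mx i h) * Xvar k * basis_mono i' u' j else acst (delta_mx i j).

Lemma basis_monoE i u j v :
  basis_mono i u j v = (v == u)%:R *: delta_mx i j.
Proof.
elim: u i v => [|[k [h i']] u IH] i [|[l [a b]] v] /=.
- by rewrite scale1r.
- by rewrite scale0r.
- by rewrite cstXE scale0r.
rewrite cstXE IH -scalerAr scalerA -!mulmxE !eqseq_cons !xpair_eqE.
rewrite mul_delta_mx_cond [h == a]eq_sym.
case: (a == h); last by rewrite mul0mx !scaler0 !andbF scale0r.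
rewrite mulr1n mul_delta_mx_cond.
case: (b == i'); last by rewrite mulr0n scaler0 !andbF scale0r.
by rewrite mulr1n !andbT /=; case: (l == k); case: (v == u);
   rewrite /= ?(mulr0, mul0r, mulr1).
Qed.

Lemma spanwD w T T' : spanw w T -> spanw w T' -> spanw w (T + T').
Proof.
move=> [L HL ->] [L' HL' ->]; exists (L ++ L'); first by rewrite all_cat HL.
by rewrite big_cat.
Qed.

Lemma spanw_sum (I : Type) (r : seq I) w (T : I -> series) :
  (forall i, spanw w (T i)) -> spanw w (\sum_(i <- r) T i).
Proof.
move=> wT; apply: big_ind => //; first by exists [::]; rewrite ?big_nil.
exact: spanwD.
Qed.

Lemma spanw_cons k w a T : spanw w T -> spanw (k :: w) (acst a * Xvar k * T).
Proof.
case=> L HL ->; exists [seq (a, (k, t.1) :: t.2) | t <- L].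
  rewrite all_map; apply: sub_all HL => t /eqP <- /=; exact: eqxx.
by rewrite big_map mulr_sumr.
Qed.

(* A^w consists of the series supported on the words lying over w *)
Lemma spanwP w T : spanw w T <-> (forall u, unzip1 u != w -> T u = 0).
Proof.
split=> [[L HL ->] u uw|].
  elim: L HL => [|[a s] L IH] /=; first by rewrite big_nil.
  case/andP=> /eqP sw /IH; rewrite big_cons ncs_addE => ->; rewrite addr0.
  move: uw; rewrite -{}sw {IH L}.
  elim: s a u => [|[k b] s IH] a [|[l [i j]] u] //=; first by rewrite cstXE.
  rewrite cstXE eqseq_cons negb_and; case/orP=> [/negbTE ->|/IH ->].
    by rewrite scale0r.
  by rewrite mulr0 scaler0.
elim: w T => [|k w IH] T supp.
  exists [:: (T [::], [::])] => //; rewrite big_seq1.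
  by apply/funext => -[|t u] //=; rewrite supp.
pose T' i j : series := fun u => T ((k, (i, j)) :: u).
have -> : T = \sum_i \sum_j \sum_h
    acst (delta_mx h i) * Xvar k * (acst (delta_mx j h) * T' i j).
  apply/funext => u.
  have sumE (I : finType) (G : I -> series) v : (\sum_i G i) v = \sum_i G i v.
    by apply: (big_morph (fun S : series => S v)).
  rewrite sumE; case: u => [|[l [a b]] u].
    rewrite supp // big1 // => i _; rewrite sumE big1 // => j _.
    by rewrite sumE big1 // => h _; rewrite cstXE.
  transitivity (\sum_i \sum_j \sum_h (l == k)%:R *:
      (delta_mx h i * delta_mx a b * (delta_mx j h * T' i j u))); last first.
    apply: eq_bigr => i _; rewrite sumE; apply: eq_bigr => j _.
    by rewrite sumE; apply: eq_bigr => h _; rewrite cstXE [(acst _ * _) _]ncs_cst_mulE.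
  rewrite (bigD1 a) //= [X in _ + X]big1 ?addr0; last first.
    move=> i /negbTE ia; rewrite big1 // => j _; rewrite big1 // => h _.
    by rewrite -mulmxE mul_delta_mx_cond ia mulr0n mul0mx scaler0.
  rewrite (bigD1 b) //= [X in _ + X]big1 ?addr0; last first.
    move=> j /negbTE jb; rewrite big1 // => h _.
    rewrite -mulmxE mul_delta_mx mulmxA mul_delta_mx_cond [b == j]eq_sym jb.
    by rewrite mulr0n mul0mx scaler0.
  under eq_bigr => h _ do
    rewrite -mulmxE mul_delta_mx mulmxA mul_delta_mx.
  rewrite -scaler_sumr -mulmx_suml.
  have -> : \sum_h delta_mx h h = 1%:M :> A by rewrite mx1_sum_delta.
  rewrite mul1mx; have [->|lk] := eqVneq l k; first by rewrite scale1r.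
  by rewrite scale0r supp // /= eqseq_cons (negbTE lk).
do 3![apply: spanw_sum => ?]; apply: spanw_cons; apply: IH => u uw.
by rewrite [LHS]ncs_cst_mulE /T' supp ?mulr0 //= eqseq_cons eqxx.
Qed.

Lemma scomp_spanw S w : spanw w (scomp S w).
Proof. by apply/spanwP => u; rewrite /scomp => /negbTE ->. Qed.

Lemma scomp_id w w' T : spanw w T -> scomp T w' = if w == w' then T else 0.
Proof.
move/spanwP => supp; apply/funext => u; rewrite /scomp.
case: (eqVneq w w') => [<-|ww'].
  by case: ifPn => // /supp.
by case: eqP => // uw'; rewrite supp // uw' eq_sym.
Qed.

End FreeProduct.

Arguments acst {F m g} a.
Arguments Xvar {F m g} k.

(* The noncommutative polynomials are the expressions without RInv; the       *)
(* constant k of F is RScale k ROne.                                          *)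
Inductive ratexpr (F : Type) (g : nat) : Type :=
  | ROne
  | RVar of 'I_g
  | RScale of F & ratexpr F g
  | RAdd of ratexpr F g & ratexpr F g
  | RMul of ratexpr F g & ratexpr F g
  | RInv of ratexpr F g.

Section Evaluation.
Variables (F : fieldType) (g : nat) (R : unitAlgType F) (v : 'I_g -> R).

Fixpoint rat_eval (r : ratexpr F g) : R :=
  match r with
  | ROne => 1
  | RVar i => v i
  | RScale k r1 => k *: rat_eval r1
  | RAdd r1 r2 => rat_eval r1 + rat_eval r2
  | RMul r1 r2 => rat_eval r1 * rat_eval r2
  | RInv r1 => (rat_eval r1)^-1
  end.

Fixpoint rat_defined (r : ratexpr F g) : bool :=
  match r with
  | ROne | RVar _ => true
  | RScale _ r1 => rat_defined r1
  | RAdd r1 r2 | RMul r1 r2 => rat_defined r1 && rat_defined r2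
  | RInv r1 => rat_defined r1 && (rat_eval r1 \is a GRing.unit)
  end.

End Evaluation.

Definition rat_dom (F : fieldType) (g m : nat) (r : ratexpr F g) :
  set (mxpoint F m g) := [set p | rat_defined p r].
Arguments rat_dom {F g} m r.

(* Meaningful for p in rat_dom m r: all inverses are then genuine by          *)
(* ncs_unitE (see rat_defined_expansion below).                               *)
Definition expansion (F : fieldType) (g m : nat) (r : ratexpr F g)
  (p : mxpoint F m g) : fpseries F m g := rat_eval (fun i => Xvar i + acst (p i)) r.

Lemma rat_defined_expansion (F : fieldType) (g m : nat) (r : ratexpr F g)
    (p : mxpoint F m g) : rat_dom m r p ->
  rat_defined (fun i => Xvar i + acst (p i) : fpseries F m g) r /\
  expansion r p [::] = rat_eval p r.
Proof.
rewrite /rat_dom /expansion /=.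
elim: r => [|i|k r IH|r IHr s IHs|r IHr s IHs|r IH] //=.
- by move=> _; rewrite ncs_addE add0r.
- by move=> /IH[-> e]; rewrite ncs_scaleE e.
- by case/andP => /IHr[-> er] /IHs[-> es]; rewrite ncs_addE er es.
- by case/andP => /IHr[-> er] /IHs[-> es]; rewrite [_ [::]]ncs_mul_nil er es.
case/andP => /IH[-> e] u; rewrite ncs_unitE e u; split=> //.
by rewrite /GRing.inv /= /ncs_inv /ncs_unit e u /= e.
Qed.

(* The affine space A^g has the matrix entries as coordinates. *)
Definition pt_coord (F : fieldType) (m g : nat) (p : mxpoint F m g)
    (l : 'I_#|{: 'I_g * ('I_m.+1 * 'I_m.+1)}|) : F :=
  let: (k, (i, j)) := enum_val l in p k i j.

Definition zariski_open (F : fieldType) (m g : nat) (O : set (mxpoint F m g)) :=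
  exists Q : set (mpoly.mpoly #|{: 'I_g * ('I_m.+1 * 'I_m.+1)}| F),
    O = [set p | exists2 q, Q q & mpoly.meval (pt_coord p) q != 0].

Section Representations.
Variables (F : fieldType) (m g : nat).
Notation A := 'M[F]_m.+1.
Notation series := (fpseries F m g).

Record rep (n : nat) := Rep {
  rc : 'rV[A]_n;
  rA : 'I_g -> 'M[series]_n;
  rb : 'cV[A]_n
}.

Definition cmx n1 n2 (M : 'M[A]_(n1, n2)) : 'M[series]_(n1, n2) :=
  map_mx (@acst F m g) M.

Definition rAw n (R : rep n) (w : seq 'I_g) : 'M[series]_n :=
  foldr (fun x M => rA R x *m M) 1%:M w.

Definition represents n (R : rep n) (S : series) : Prop :=
  (forall x i j, spanw [:: x] (rA R x i j)) /\
  (forall w, scomp S w = (cmx (rc R) *m rAw R w *m cmx (rb R)) 0 0).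

Definition obsL n (R : rep n) (u : 'rV[A]_n) : Prop :=
  forall w, cmx u *m rAw R w *m cmx (rb R) = 0.

Definition obsR n (R : rep n) (v : 'cV[A]_n) : Prop :=
  forall w, cmx (rc R) *m rAw R w *m cmx v = 0.

Definition totally_reduced n (R : rep n) : Prop :=
  (forall u, obsL R u -> u = 0) /\ (forall v, obsR R v -> v = 0).

Definition reduced n (R : rep n) : Prop :=
  (forall u, obsL R u -> exists2 a : A, a != 0 & a *: u = 0) /\
  (forall v, obsR R v -> exists2 a : A, a != 0 & v *m a%:M = 0).

Definition rep_one : rep 1 := Rep 1%:M (fun=> 0) 1%:M.

Definition rep_var (i : 'I_g) (a : A) : rep (1 + 1) :=
  Rep (row_mx 1%:M a%:M)
      (fun j => block_mx 0 (if i == j then Xvar j else 0)%:M 0 0)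
      (col_mx 0 1%:M).

Definition rep_scale n (a : A) (R : rep n) : rep n :=
  Rep (a *: rc R) (rA R) (rb R).

Definition rep_add n1 n2 (R1 : rep n1) (R2 : rep n2) : rep (n1 + n2) :=
  Rep (row_mx (rc R1) (rc R2))
      (fun x => block_mx (rA R1 x) 0 0 (rA R2 x))
      (col_mx (rb R1) (rb R2)).

Definition rep_mul n1 n2 (R1 : rep n1) (R2 : rep n2) : rep (n1 + n2) :=
  Rep (row_mx (rc R1) (rc R1 *m rb R1 *m rc R2))
      (fun x => block_mx (rA R1 x) (rA R1 x *m cmx (rb R1 *m rc R2))
                         0 (rA R2 x))
      (col_mx 0 (rb R2)).

(* a is the constant term of the inverted series *)
Definition rep_inv n (a : A) (R : rep n) : rep (n + 1) :=
  Rep (row_mx (- (a^-1 *: rc R)) a^-1%:M)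
      (fun x => block_mx
         (rA R x *m cmx (1%:M - rb R *m a^-1%:M *m rc R))
         (rA R x *m cmx (rb R *m a^-1%:M))
         0 0)
      (col_mx 0 1%:M).

Fixpoint standard (r : ratexpr F g) (p : mxpoint F m g) : {n & rep n} :=
  match r with
  | ROne => existT _ _ rep_one
  | RVar i => existT _ _ (rep_var i (p i))
  | RScale k r1 => existT _ _ (rep_scale k%:A (projT2 (standard r1 p)))
  | RAdd r1 r2 =>
      existT _ _ (rep_add (projT2 (standard r1 p)) (projT2 (standard r2 p)))
  | RMul r1 r2 =>
      existT _ _ (rep_mul (projT2 (standard r1 p)) (projT2 (standard r2 p)))
  | RInv r1 =>
      existT _ _ (rep_inv (expansion r1 p [::]) (projT2 (standard r1 p)))
  end.

(* Left independence and bases concern the rows, the right notions the        *)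
(* columns.                                                                   *)
Definition lfree d n (B : 'M[A]_(d, n)) : Prop :=
  forall a : 'rV_d, a *m B = 0 -> a = 0.
Definition rfree n d (B : 'M[A]_(n, d)) : Prop :=
  forall a : 'cV_d, B *m a = 0 -> a = 0.

Definition lbasis n (U : 'M[A]_n) : Prop :=
  lfree U /\ forall u : 'rV_n, exists a, u = a *m U.
Definition rbasis n (V : 'M[A]_n) : Prop :=
  rfree V /\ forall v : 'cV_n, exists a, v = V *m a.

Definition max_lfree d n (P : 'rV[A]_n -> Prop) (B : 'M[A]_(d, n)) : Prop :=
  [/\ lfree B, forall i, P (row i B) & forall u, P u -> ~ lfree (col_mx B u)].
Definition max_rfree n d (P : 'cV[A]_n -> Prop) (B : 'M[A]_(n, d)) : Prop :=
  [/\ rfree B, forall i, P (col i B) & forall v, P v -> ~ rfree (row_mx B v)].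

Definition inverse_mx n (U V : 'M[A]_n) : Prop :=
  U *m V = 1%:M /\ V *m U = 1%:M.

(* true marks a left step, false a right step *)
Inductive step : bool -> forall n k, rep n -> rep k -> Prop :=
  | LeftStep k d (R : rep (k + d)) (C : 'M[A]_(k, k + d)) (B : 'M[A]_(d, k + d))
      (Ui : 'M[A]_(k + d)) (U := col_mx C B) :
      max_lfree (obsL R) B -> lbasis U -> inverse_mx U Ui ->
      step true R
        (Rep (lsubmx (rc R *m Ui))
             (fun x => ulsubmx (cmx U *m rA R x *m cmx Ui))
             (usubmx (U *m rb R)))
  | RightStep k d (R : rep (k + d)) (C : 'M[A]_(k + d, k))
      (B : 'M[A]_(k + d, d)) (Vi : 'M[A]_(k + d)) (V := row_mx C B) :
      max_rfree (obsR R) B -> rbasis V -> inverse_mx V Vi ->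
      step false R
        (Rep (lsubmx (rc R *m V))
             (fun x => ulsubmx (cmx Vi *m rA R x *m cmx V))
             (usubmx (Vi *m rb R))).

(* alternating steps, the first one on side s, ending with the first result   *)
(* that is reduced                                                            *)
Inductive alternate : bool -> forall n k, rep n -> rep k -> Prop :=
  | AltStop s n k (R : rep n) (R' : rep k) :
      step s R R' -> reduced R' -> alternate s R R'
  | AltNext s n l k (R : rep n) (R1 : rep l) (R' : rep k) :
      step s R R1 -> ~ reduced R1 -> alternate (~~ s) R1 R' -> alternate s R R'.

Definition reduction n k (R : rep n) (R' : rep k) : Prop := alternate true R R'.

End Representations.

(* Main.v *)
Require Import Defs.
From HB Require Import structures.
From mathcomp Require Import all_boot all_order all_algebra.
From mathcomp Require Import zify.
From mathcomp Require Import boolp classical_sets.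
From mathcomp.multinomials Require mpoly.
Import -(notations) mpoly.
Import GRing.Theory.
Local Open Scope classical_set_scope.
Local Open Scope ring_scope.

Set Implicit Arguments.
Unset Strict Implicit.
Unset Printing Implicit Defensive.

(** Write [A] for the algebra of matrices of size [M] over [F].  Replacing the
    entries of matrices over [A] by blocks ([flat]) turns a representation into
    a linear system over the field [F].  Its uncontrollable rows form a left
    [A]-module, which is free as soon as its dimension is a multiple of that of
    [A], that is, as soon as the rank of the controllability matrix is a
    multiple of [M] ([left_kernel_basis]).  If so, a left step removes a free
    module and leaves a controllable representation; if the rank of the Hankel
    matrix is also a multiple of [M], then the unobservable states of that
    representation form a free module as well, and a right step that removes it
    yields a totally reduced representation ([reduction_exists]).

    It remains to see that both ranks are multiples of [M] at a general point.
    The entries of the standard construction are rational functions of the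
    point, so that minors show that the ranks are largest, and constant, on a
    nonempty Zariski open set, where they agree with the ranks at any point with
    algebraically independent coordinates over an extension of [F]
    ([rank_semicontinuous], [generic_point_eval]).

    A good choice of such a point is the classical reason why generic matrices
    lie in a division algebra.  Over the field [K] of rational functions in the
    coordinates [y] and in one more indeterminate [t], let [sigma] permute the
    [y] cyclically and let [C] be the companion matrix with [C ^+ M = t].  The
    powers of [t] in [generic_point] are chosen so that every matrix [X] of the
    point satisfies [sigma X * C = C * X].  The standard construction is natural
    in the ring ([map_stdsys]), hence inherits this relation, and the row span
    of its observability matrix, the kernel of its controllability matrix and
    their intersection are spaces [V] with [sigma V * C = V].  A basis of [V]
    gives [sigma V * C = L * V] with a square matrix [L]; after [M] iterations
    [t ^+ \rank V] is the norm of [\det L], and comparing degrees in [t] gives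
    that [M] divides the dimension of [V] ([twisted_rank], [norm_degree]). *)

(** * Matrices over a matrix algebra, and freeness of their kernels *)

Section Flattening.
Variables (F : fieldType) (m : nat).
Notation M := m.+1.
Notation A := 'M[F]_M.

Definition unindex p (a : 'I_(p * M)) : 'I_p * 'I_M :=
  mxvec (\matrix_(i, k) (i, k)) 0 a.

Definition flat p q (X : 'M[A]_(p, q)) : 'M[F]_(p * M, q * M) :=
  \matrix_(a, b) X (unindex a).1 (unindex b).1 (unindex a).2 (unindex b).2.

Definition unflat p q (Y : 'M[F]_(p * M, q * M)) : 'M[A]_(p, q) :=
  \matrix_(i, j) \matrix_(k, l) Y (mxvec_index i k) (mxvec_index j l).

Lemma mxvec_indexK p (i : 'I_p) (k : 'I_M) : unindex (mxvec_index i k) = (i, k).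
Proof. by rewrite /unindex mxvecE mxE. Qed.

Lemma flatE p q (X : 'M[A]_(p, q)) i j k l :
  flat X (mxvec_index i k) (mxvec_index j l) = X i j k l.
Proof. by rewrite mxE !mxvec_indexK. Qed.

Lemma flatP p q (Y Z : 'M[F]_(p * M, q * M)) :
  (forall i j k l, Y (mxvec_index i k) (mxvec_index j l) =
                   Z (mxvec_index i k) (mxvec_index j l)) -> Y = Z.
Proof.
move=> YZ; apply/matrixP => a b.
by case/mxvec_indexP: a => i k; case/mxvec_indexP: b => j l.
Qed.

Lemma flatK p q : cancel (@flat p q) (@unflat p q).
Proof.
by move=> X; apply/matrixP => i j; apply/matrixP => k l; rewrite !mxE !mxvec_indexK.
Qed.

Lemma unflatK p q : cancel (@unflat p q) (@flat p q).
Proof. by move=> Y; apply: flatP => i j k l; rewrite flatE !mxE. Qed.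

Lemma flat_inj p q : injective (@flat p q). Proof. exact: can_inj (@flatK p q). Qed.

Lemma flat0 p q : flat (0 : 'M[A]_(p, q)) = 0.
Proof. by apply: flatP => i j k l; rewrite flatE !mxE. Qed.

Lemma flatD p q (X Y : 'M[A]_(p, q)) : flat (X + Y) = flat X + flat Y.
Proof. by apply: flatP => i j k l; rewrite flatE !mxE !mxvec_indexK. Qed.

Lemma flatM p q r (X : 'M[A]_(p, q)) (Y : 'M[A]_(q, r)) :
  flat (X *m Y) = flat X *m flat Y.
Proof.
apply: flatP => i j k l; rewrite flatE !mxE summxE.
rewrite (reindex _ (curry_mxvec_bij _ _)) /=.
transitivity (\sum_h \sum_s X i h k s * Y h j s l).
  by apply: eq_bigr => h _; rewrite -mulmxE mxE.
by rewrite pair_bigA; apply: eq_bigr => -[h s] _; rewrite /= !flatE.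
Qed.

Lemma flat1 n : flat (1%:M : 'M[A]_n) = 1%:M.
Proof.
apply: flatP => i j k l; rewrite flatE !mxE.
have -> : (mxvec_index i k == mxvec_index j l) = (i == j) && (k == l).
  apply/eqP/andP => [e|[/eqP-> /eqP->] //].
  by have := mxvec_indexK i k; rewrite e mxvec_indexK => -[-> ->].
by case: (i == j); rewrite ?mulr0n !mxE.
Qed.

Lemma flat_mulC n (X Y : 'M[A]_n) : X *m Y = 1%:M -> Y *m X = 1%:M.
Proof. by move=> XY; apply: flat_inj; rewrite flatM flat1 mulmx1C // -flatM XY flat1. Qed.

Lemma flat_submx p q r (X : 'M[A]_(p, q)) (Y : 'M[A]_(r, q)) :
  (flat X <= flat Y)%MS -> exists a, X = a *m Y.
Proof.
by case/submxP => D XD; exists (unflat D); apply: flat_inj; rewrite flatM unflatK.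
Qed.

(** The rows over [A] that [Z] kills form a left module over a simple algebra,
    determined up to isomorphism by its dimension: its flattened rows fill the
    left kernel of [Z], so that it is free when the dimension of that kernel is
    a multiple of [M].  A complement is then free for the same reason. *)
Lemma left_kernel_basis k d q (Z : 'M[F]_((k + d) * M, q)) :
  \rank Z = (k * M)%N ->
  exists (C : 'M[A]_(k, k + d)) (B : 'M[A]_(d, k + d)) (Ui : 'M[A]_(k + d)),
    [/\ inverse_mx (col_mx C B) Ui, flat B *m Z = 0 &
        forall s (u : 'M[A]_(s, k + d)), flat u *m Z = 0 ->
          exists a, u = a *m B].
Proof.
move=> rZ; pose K := kermx Z.
have rK : \rank K = (d * M)%N by rewrite mxrank_ker rZ mulnDl addKn.
have rKC : \rank (K^C)%MS = (k * M)%N by rewrite mxrank_compl rK mulnDl addnK.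
pose B0 := castmx (rK, erefl _) (row_base K).
pose C0 := castmx (rKC, erefl _) (row_base K^C%MS).
have B0K : (B0 :=: K)%MS by apply: eqmx_trans (eqmx_cast _ _) (eq_row_base _).
have C0K : (C0 :=: K^C)%MS by apply: eqmx_trans (eqmx_cast _ _) (eq_row_base _).
pose C := unflat C0; pose B := unflat B0.
have [V VE] : exists V, V *m col_mx C B = 1%:M.
  have : (1%:M <= C0 + B0)%MS.
    by rewrite addsmxC (adds_eqmx B0K C0K) submx_full // addsmx_compl_full.
  case/sub_addsmxP => -[D E] /= DE; exists (row_mx (unflat D) (unflat E)).
  by apply: flat_inj; rewrite mul_row_col flatD !flatM !unflatK flat1.
exists C, B, V; split.
- by split=> //; apply: flat_mulC.
- by rewrite unflatK; apply/sub_kermxP; rewrite B0K.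
- by move=> s u /sub_kermxP uK; apply: flat_submx; rewrite unflatK B0K.
Qed.

(** Transposing both the blocks and their arrangement reverses products, which
    exchanges left and right modules. *)
Definition dagger p q (X : 'M[A]_(p, q)) : 'M[A]_(q, p) := unflat (flat X)^T.

Lemma flat_dagger p q (X : 'M[A]_(p, q)) : flat (dagger X) = (flat X)^T.
Proof. by rewrite unflatK. Qed.

Lemma daggerK p q (X : 'M[A]_(p, q)) : dagger (dagger X) = X.
Proof. by apply: flat_inj; rewrite !flat_dagger trmxK. Qed.

Lemma daggerM p q r (X : 'M[A]_(p, q)) (Y : 'M[A]_(q, r)) :
  dagger (X *m Y) = dagger Y *m dagger X.
Proof. by apply: flat_inj; rewrite flatM !flat_dagger flatM trmx_mul. Qed.

Lemma dagger1 n : dagger (1%:M : 'M[A]_n) = 1%:M.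
Proof. by apply: flat_inj; rewrite flat_dagger flat1 trmx1. Qed.

Lemma daggerE p q (X : 'M[A]_(p, q)) i j : dagger X i j = (X j i)^T.
Proof.
by apply/matrixP => k l; rewrite !mxE !mxvec_indexK.
Qed.

Lemma dagger_col_mx p1 p2 q (X : 'M[A]_(p1, q)) (Y : 'M[A]_(p2, q)) :
  dagger (col_mx X Y) = row_mx (dagger X) (dagger Y).
Proof.
by apply/matrixP => i j; rewrite daggerE !mxE; case: splitP => h _; rewrite daggerE.
Qed.

Lemma right_kernel_basis k d q (Z : 'M[F]_(q, (k + d) * M)) :
  \rank Z = (k * M)%N ->
  exists (C : 'M[A]_(k + d, k)) (B : 'M[A]_(k + d, d)) (Vi : 'M[A]_(k + d)),
    [/\ inverse_mx (row_mx C B) Vi, Z *m flat B = 0 &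
        forall s (v : 'M[A]_(k + d, s)), Z *m flat v = 0 ->
          exists a, v = B *m a].
Proof.
rewrite -mxrank_tr => /left_kernel_basis[C [B [Ui [[CU UC] BZ ZB]]]].
exists (dagger C), (dagger B), (dagger Ui); split.
- by split; rewrite -dagger_col_mx -daggerM ?CU ?UC dagger1.
- by apply: trmx_inj; rewrite trmx_mul trmx0 flat_dagger trmxK.
move=> s v Zv; have [|a va] := ZB s (dagger v).
  by rewrite flat_dagger -trmx_mul Zv trmx0.
by exists (dagger a); rewrite -daggerM -va daggerK.
Qed.

End Flattening.

(** * Linear systems, their compressions and their Hankel matrices *)

(** A representation is a linear system with one state matrix for each letter;
    [coef] is the coefficient at a word of the series that it represents. *)
Record sys (T : Type) (R : nzRingType) (n : nat) := Sys {
  sc : 'rV[R]_n;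
  sN : T -> 'M[R]_n;
  sb : 'cV[R]_n
}.

Section Systems.
Variables (T : Type) (R : nzRingType).

Definition wordmx n (N : T -> 'M[R]_n) (w : seq T) : 'M[R]_n :=
  foldr (fun t X => N t *m X) 1%:M w.

Lemma wordmx_cat n (N : T -> 'M[R]_n) u w :
  wordmx N (u ++ w) = wordmx N u *m wordmx N w.
Proof. by elim: u => [|t u IH] /=; rewrite ?mul1mx // IH mulmxA. Qed.

Lemma wordmx_rcons n (N : T -> 'M[R]_n) u t :
  wordmx N (rcons u t) = wordmx N u *m N t.
Proof. by rewrite -cats1 wordmx_cat /= mulmx1. Qed.

Definition coef n (S : sys T R n) (w : seq T) : R :=
  (sc S *m wordmx (sN S) w *m sb S) 0 0.

Definition unctr n (S : sys T R n) s (u : 'M[R]_(s, n)) : Prop :=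
  forall w, u *m wordmx (sN S) w *m sb S = 0.

Definition unobs n (S : sys T R n) s (v : 'M[R]_(n, s)) : Prop :=
  forall w, sc S *m wordmx (sN S) w *m v = 0.

Definition compress n k (P : 'M[R]_(k, n)) (Q : 'M[R]_(n, k)) (S : sys T R n) :
  sys T R k := Sys (sc S *m Q) (fun t => P *m sN S t *m Q) (P *m sb S).

(** Compressing onto a space that contains all the reachable states
    [wordmx w *m sb] keeps the reachable states. *)
Lemma compress_left n k (P : 'M[R]_(k, n)) (Q : 'M[R]_(n, k)) (S : sys T R n) :
    (forall w, Q *m P *m (wordmx (sN S) w *m sb S) = wordmx (sN S) w *m sb S) ->
  (forall w, coef (compress P Q S) w = coef S w) /\
  (forall s (u : 'M_(s, k)), unctr (compress P Q S) u -> unctr S (u *m P)).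
Proof.
move=> fixQP; have reach w : wordmx (sN (compress P Q S)) w *m (P *m sb S) =
    P *m (wordmx (sN S) w *m sb S).
  elim: w => [|t w IH] /=; first by rewrite !mul1mx.
  by rewrite -!mulmxA IH (mulmxA Q) fixQP !mulmxA.
split=> [w|s u unc w].
  by rewrite /coef -mulmxA reach -[in RHS]mulmxA -[in RHS]fixQP !mulmxA.
by rewrite -[RHS](unc w) -!mulmxA reach.
Qed.

(** Dually, one may divide by a stable space of unobservable states, here the
    kernel of [P]. *)
Lemma compress_right n k (P : 'M[R]_(k, n)) (Q : 'M[R]_(n, k)) (S : sys T R n) :
    (forall t, P *m sN S t *m Q *m P = P *m sN S t) ->
    (forall w, sc S *m wordmx (sN S) w *m Q *m P = sc S *m wordmx (sN S) w) ->
  [/\ forall w, coef (compress P Q S) w = coef S w,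
      forall s (u : 'M_(s, k)), unctr (compress P Q S) u -> unctr S (u *m P) &
      forall s (v : 'M_(k, s)), unobs (compress P Q S) v -> unobs S (Q *m v)].
Proof.
move=> stableP fixQP.
have reach w : wordmx (sN (compress P Q S)) w *m P = P *m wordmx (sN S) w.
  elim: w => [|t w IH] /=; first by rewrite mul1mx mulmx1.
  by rewrite -mulmxA IH mulmxA stableP !mulmxA.
have obs w : sc S *m Q *m wordmx (sN (compress P Q S)) w =
    sc S *m wordmx (sN S) w *m Q.
  elim/last_ind: w => [|w t IH]; first by rewrite !mulmx1.
  rewrite !wordmx_rcons mulmxA IH /= !mulmxA.
  by rewrite fixQP.
split=> [w|s u unc w|s v uno w].
- rewrite /coef /= obs -!mulmxA (mulmxA Q) !mulmxA.
  by rewrite fixQP.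
- by rewrite -(mulmxA u) -reach -[RHS](unc w) -!mulmxA.
- by rewrite -[RHS](uno w) mulmxA /= obs.
Qed.

(** Coordinates in which the last basis vectors span the uncontrollable rows:
    dropping these vectors leaves no uncontrollable row. *)
Lemma left_step_sys k d (S : sys T R (k + d)) (C : 'M[R]_(k, k + d))
    (B : 'M[R]_(d, k + d)) (Ui : 'M[R]_(k + d)) :
    col_mx C B *m Ui = 1%:M /\ Ui *m col_mx C B = 1%:M -> unctr S B ->
    (forall s (u : 'M_(s, k + d)), unctr S u -> exists a, u = a *m B) ->
  (forall w, coef (compress C (lsubmx Ui) S) w = coef S w) /\
  (forall s (u : 'M_(s, k)), unctr (compress C (lsubmx Ui) S) u -> u = 0).
Proof.
set Q := lsubmx Ui; move=> [UV VU] uncB spanB.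
have VE : Ui = row_mx Q (rsubmx Ui) by rewrite hsubmxK.
have [CQ BQ] : C *m Q = 1%:M /\ B *m Q = 0.
  move: UV; rewrite VE mul_col_row (@scalar_mx_block R k d 1).
  by case/eq_block_mx.
have QC : Q *m C = 1%:M - rsubmx Ui *m B.
  by move: VU; rewrite {1}VE mul_row_col => <-; rewrite addrK.
have fixQC w : Q *m C *m (wordmx (sN S) w *m sb S) = wordmx (sN S) w *m sb S.
  rewrite QC mulmxBl mul1mx -mulmxA [B *m _]mulmxA uncB mulmx0 subr0 //.
have [coefE uncE] := compress_left fixQC; split=> // s u unc.
have [a aB] := spanB _ _ (uncE _ _ unc).
by rewrite -[u]mulmx1 -CQ mulmxA aB -mulmxA BQ mulmx0.
Qed.

Lemma right_step_sys k d (S : sys T R (k + d)) (C : 'M[R]_(k + d, k))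
    (B : 'M[R]_(k + d, d)) (Vi : 'M[R]_(k + d)) :
    row_mx C B *m Vi = 1%:M /\ Vi *m row_mx C B = 1%:M -> unobs S B ->
    (forall s (v : 'M_(k + d, s)), unobs S v -> exists a, v = B *m a) ->
    (forall s (u : 'M_(s, k + d)), unctr S u -> u = 0) ->
  [/\ forall w, coef (compress (usubmx Vi) C S) w = coef S w,
      forall s (u : 'M_(s, k)), unctr (compress (usubmx Vi) C S) u -> u = 0 &
      forall s (v : 'M_(k, s)), unobs (compress (usubmx Vi) C S) v -> v = 0].
Proof.
set P := usubmx Vi; move=> [UV VU] unoB spanB ctrS.
have VE : Vi = col_mx P (dsubmx Vi) by rewrite vsubmxK.
have [PC PB] : P *m C = 1%:M /\ P *m B = 0.
  move: VU; rewrite VE mul_col_row (@scalar_mx_block R k d 1).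
  by case/eq_block_mx.
have CP : C *m P = 1%:M - B *m dsubmx Vi.
  by move: UV; rewrite {1}VE mul_row_col => <-; rewrite addrK.
have stableP t : P *m sN S t *m C *m P = P *m sN S t.
  have [|Y YE] := spanB _ (sN S t *m B).
    by move=> w; rewrite mulmxA -(mulmxA (sc S)) -wordmx_rcons unoB.
  rewrite -[LHS]mulmxA CP mulmxBr mulmx1 mulmxA -(mulmxA P) YE mulmxA PB.
  by rewrite !mul0mx subr0.
have fixCP w : sc S *m wordmx (sN S) w *m C *m P = sc S *m wordmx (sN S) w.
  by rewrite -[LHS]mulmxA CP mulmxBr mulmx1 mulmxA unoB mul0mx subr0.
have [coefE uncE unoE] := compress_right stableP fixCP; split=> // s.
- move=> u /uncE /ctrS uP.
  by rewrite -[u]mulmx1 -PC mulmxA uP mul0mx.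
move=> v /unoE /spanB[a CvB].
by rewrite -[v]mul1mx -PC -mulmxA CvB mulmxA PB mul0mx.
Qed.

Definition obsmx n (S : sys T R n) q (us : 'I_q -> seq T) : 'M[R]_(q, n) :=
  \matrix_(i, j) (sc S *m wordmx (sN S) (us i)) 0 j.

Definition ctrmx n (S : sys T R n) q (ws : 'I_q -> seq T) : 'M[R]_(n, q) :=
  \matrix_(i, j) (wordmx (sN S) (ws j) *m sb S) i 0.

Lemma row_obsmx n (S : sys T R n) q (us : 'I_q -> seq T) i :
  row i (obsmx S us) = sc S *m wordmx (sN S) (us i).
Proof. by apply/rowP => j; rewrite !mxE. Qed.

Lemma col_ctrmx n (S : sys T R n) q (ws : 'I_q -> seq T) j :
  col j (ctrmx S ws) = wordmx (sN S) (ws j) *m sb S.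
Proof. by apply/colP => i; rewrite !mxE. Qed.

Lemma hankelE n (S : sys T R n) q (us : 'I_q -> seq T) q' (ws : 'I_q' -> seq T) :
  obsmx S us *m ctrmx S ws = \matrix_(i, j) coef S (us i ++ ws j).
Proof.
apply/matrixP => i j; rewrite [RHS]mxE /coef wordmx_cat mulmxA -mulmxA.
by rewrite -row_obsmx -col_ctrmx !mxE; apply: eq_bigr => h _; rewrite !mxE.
Qed.

End Systems.

Section Ranks.
Variables (F : fieldType) (m : nat) (T : Type).
Notation M := m.+1.
Notation A := 'M[F]_M.

Definition ctr_rank n (S : sys T A n) (h : nat) : Prop :=
  (exists q (ws : 'I_q -> seq T), \rank (flat (ctrmx S ws)) = h) /\
  (forall q (ws : 'I_q -> seq T), (\rank (flat (ctrmx S ws)) <= h)%N).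

Definition obs_rank n (S : sys T A n) (h : nat) : Prop :=
  (exists q (us : 'I_q -> seq T), \rank (flat (obsmx S us)) = h) /\
  (forall q (us : 'I_q -> seq T), (\rank (flat (obsmx S us)) <= h)%N).

Definition hankel_rank n (S : sys T A n) (h : nat) : Prop :=
  (exists q (us : 'I_q -> seq T) q' (ws : 'I_q' -> seq T),
     \rank (flat (obsmx S us *m ctrmx S ws)) = h) /\
  (forall q (us : 'I_q -> seq T) q' (ws : 'I_q' -> seq T),
     (\rank (flat (obsmx S us *m ctrmx S ws)) <= h)%N).

Lemma bounded_max (P : nat -> Prop) N : (exists h, P h) ->
  (forall h, P h -> (h <= N)%N) -> exists h, P h /\ forall h', P h' -> (h' <= h)%N.
Proof.
move=> exP leN; have exb : exists h, `[<P h>] by case: exP => h /asboolP; exists h.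
have leb h : `[<P h>] -> (h <= N)%N by move/asboolP/leN.
by case: (ex_maxnP exb leb) => h /asboolP Ph maxh; exists h; split=> // h' /asboolP/maxh.
Qed.

Lemma ctr_rank_exists n (S : sys T A n) : exists h, ctr_rank S h.
Proof.
have [||h [Ph maxh]] := @bounded_max
    (fun h => exists q (ws : 'I_q -> seq T), \rank (flat (ctrmx S ws)) = h) (n * M).
- by exists (\rank (flat (ctrmx S (fun _ : 'I_0 => [::])))), 0, (fun=> [::]).
- by move=> h [q [ws <-]]; apply: rank_leq_row.
by exists h; split=> // q ws; apply: maxh; exists q, ws.
Qed.

Lemma obs_rank_exists n (S : sys T A n) : exists h, obs_rank S h.
Proof.
have [||h [Ph maxh]] := @bounded_max
    (fun h => exists q (us : 'I_q -> seq T), \rank (flat (obsmx S us)) = h) (n * M).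
- by exists (\rank (flat (obsmx S (fun _ : 'I_0 => [::])))), 0, (fun=> [::]).
- by move=> h [q [us <-]]; apply: rank_leq_col.
by exists h; split=> // q us; apply: maxh; exists q, us.
Qed.

Lemma hankel_rank_exists n (S : sys T A n) : exists h, hankel_rank S h.
Proof.
have [||h [Ph maxh]] := @bounded_max (fun h => exists q (us : 'I_q -> seq T) q'
    (ws : 'I_q' -> seq T), \rank (flat (obsmx S us *m ctrmx S ws)) = h) (n * M).
- pose e (_ : 'I_0) : seq T := [::].
  by exists (\rank (flat (obsmx S e *m ctrmx S e))), 0, e, 0, e.
- move=> h [q [us [q' [ws <-]]]]; rewrite flatM.
  exact: leq_trans (mxrankM_maxl _ _) (rank_leq_col _).
by exists h; split=> // q us q' ws; apply: maxh; exists q, us, q', ws.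
Qed.

Lemma ctr_absorb n (S : sys T A n) h q (ws : 'I_q -> seq T) w :
    ctr_rank S h -> \rank (flat (ctrmx S ws)) = h ->
  exists D, flat (wordmx (sN S) w *m sb S) = flat (ctrmx S ws) *m D.
Proof.
move=> [_ maxh] rkh; set X := ctrmx S ws; set y := wordmx _ w *m _.
pose ws' (i : 'I_(q + 1)) := if split i is inl j then ws j else w.
have XyE : ctrmx S ws' = row_mx X y.
  apply/matrixP => i j; rewrite !mxE /ws'; case: splitP => h' _; rewrite ?mxE //.
  by rewrite (ord1 h').
have XE : X = row_mx X y *m col_mx 1%:M 0 by rewrite mul_row_col mulmx1 mulmx0 addr0.
have yE : y = row_mx X y *m col_mx 0 1%:M by rewrite mul_row_col mulmx1 mulmx0 add0r.
have le1 : ((flat X)^T <= (flat (row_mx X y))^T)%MS.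
  by rewrite [X in (flat X)^T]XE flatM trmx_mul submxMl.
have /submxP[D DE] : ((flat y)^T <= (flat X)^T)%MS.
  have le2 : ((flat y)^T <= (flat (row_mx X y))^T)%MS.
    by rewrite [X in (flat X)^T]yE flatM trmx_mul submxMl.
  apply: submx_trans le2 _; rewrite -(geq_leqif (mxrank_leqif_sup le1)).
  by rewrite !mxrank_tr rkh -XyE.
by exists D^T; apply: trmx_inj; rewrite trmx_mul trmxK.
Qed.

Lemma obs_absorb n (S : sys T A n) h q (us : 'I_q -> seq T) w :
    obs_rank S h -> \rank (flat (obsmx S us)) = h ->
  (flat (sc S *m wordmx (sN S) w) <= flat (obsmx S us))%MS.
Proof.
move=> [_ maxh] rkh; set X := obsmx S us; set y := _ *m wordmx _ w.
pose us' (i : 'I_(q + 1)) := if split i is inl j then us j else w.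
have XyE : obsmx S us' = col_mx X y.
  apply/matrixP => i j; rewrite !mxE /us'; case: splitP => h' _; rewrite ?mxE //.
  by rewrite (ord1 h').
have XE : X = row_mx 1%:M 0 *m col_mx X y by rewrite mul_row_col mul1mx mul0mx addr0.
have yE : y = row_mx 0 1%:M *m col_mx X y by rewrite mul_row_col mul1mx mul0mx add0r.
have le1 : (flat X <= flat (col_mx X y))%MS.
  by rewrite [X in (flat X <= _)%MS]XE flatM submxMl.
have le2 : (flat y <= flat (col_mx X y))%MS.
  by rewrite [X in (flat X <= _)%MS]yE flatM submxMl.
apply: submx_trans le2 _; rewrite -(geq_leqif (mxrank_leqif_sup le1)).
by rewrite rkh -XyE.
Qed.

Lemma unctrP n (S : sys T A n) h q (ws : 'I_q -> seq T) s (u : 'M_(s, n)) :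
    ctr_rank S h -> \rank (flat (ctrmx S ws)) = h ->
  (flat u *m flat (ctrmx S ws) = 0 <-> unctr S u).
Proof.
move=> ctrh rkh; split=> [uX w|uX].
  have [D DE] := ctr_absorb w ctrh rkh.
  by apply: flat_inj; rewrite -mulmxA flatM DE mulmxA uX mul0mx flat0.
rewrite -flatM (_ : u *m _ = 0) ?flat0 //; apply/matrixP => i j.
have -> : (u *m ctrmx S ws) i j = (u *m col j (ctrmx S ws)) i 0.
  by rewrite colE mulmxA -colE [RHS]mxE.
by rewrite col_ctrmx mulmxA uX !mxE.
Qed.

Lemma unobsP n (S : sys T A n) h q (us : 'I_q -> seq T) s (v : 'M_(n, s)) :
    obs_rank S h -> \rank (flat (obsmx S us)) = h ->
  (flat (obsmx S us) *m flat v = 0 <-> unobs S v).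
Proof.
move=> obsh rkh; split=> [vX w|vX].
  have /submxP[D DE] := obs_absorb w obsh rkh.
  by apply: flat_inj; rewrite flatM DE -mulmxA vX mulmx0 flat0.
rewrite -flatM (_ : _ *m v = 0) ?flat0 //; apply/row_matrixP => i.
by rewrite row_mul row_obsmx vX row0.
Qed.

(** In a controllable system the controllability matrix has full row rank, so
    that it can be cancelled from the Hankel matrix. *)
Lemma hankel_obs_rank n (S : sys T A n) h :
    (forall s (u : 'M_(s, n)), unctr S u -> u = 0) ->
  hankel_rank S h -> obs_rank S h.
Proof.
move=> ctrS [[q [us [q' [ws rkh]]]] maxh].
have [c ctrc] := ctr_rank_exists S; have [[q1 [ws1 rkc]] _] := ctrc.
have free1 : row_free (flat (ctrmx S ws1)).
  rewrite -kermx_eq0; apply/eqP; rewrite -[kermx _]unflatK.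
  rewrite [unflat _]ctrS ?flat0 //; apply/(unctrP _ ctrc rkc).
  by rewrite unflatK mulmx_ker.
have rkE p (vs : 'I_p -> seq T) :
    \rank (flat (obsmx S vs)) = \rank (flat (obsmx S vs *m ctrmx S ws1)).
  by rewrite flatM mxrankMfree.
split=> [|p vs]; last by rewrite rkE.
exists q, us; apply/eqP; rewrite eqn_leq {1}rkE maxh /= -rkh flatM.
exact: mxrankM_maxl.
Qed.

End Ranks.

(** * Representations as linear systems *)

Lemma hankel_rank_coef (F : fieldType) (m : nat) (T : Type) n k
    (S : sys T 'M[F]_m.+1 n) (S' : sys T 'M[F]_m.+1 k) h :
  (forall w, coef S w = coef S' w) -> hankel_rank S h -> hankel_rank S' h.
Proof.
move=> eqc; have eqH q (us : 'I_q -> seq T) q' (ws : 'I_q' -> seq T) :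
    obsmx S us *m ctrmx S ws = obsmx S' us *m ctrmx S' ws.
  by rewrite !hankelE; apply/matrixP => i j; rewrite !mxE eqc.
case=> -[q [us [q' [ws rkh]]]] maxh; split.
  by exists q, us, q', ws; rewrite -eqH.
by move=> *; rewrite -eqH.
Qed.

Section RepSystem.
Variables (F : fieldType) (m g : nat).
Notation M := m.+1.
Notation A := 'M[F]_M.
Notation series := (fpseries F m g).
Notation letter := ('I_g * ('I_M * 'I_M))%type.

Definition mxat p q (X : 'M[series]_(p, q)) (u : seq letter) : 'M[A]_(p, q) :=
  map_mx (fun S : series => S u) X.

Lemma series_sumE (I : finType) (f : I -> series) u : (\sum_i f i) u = \sum_i f i u.
Proof. by apply: (big_morph (fun S : series => S u)). Qed.

Lemma mxat_cmxl p q r (P : 'M[A]_(p, q)) (X : 'M[series]_(q, r)) u :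
  mxat (cmx g P *m X) u = P *m mxat X u.
Proof.
apply/matrixP => i j; rewrite !mxE series_sumE; apply: eq_bigr => h _.
by rewrite !mxE; apply: ncs_cst_mulE.
Qed.

Lemma mxat_cmxr p q r (X : 'M[series]_(p, q)) (P : 'M[A]_(q, r)) u :
  mxat (X *m cmx g P) u = mxat X u *m P.
Proof.
apply/matrixP => i j; rewrite !mxE series_sumE; apply: eq_bigr => h _.
by rewrite !mxE; apply: ncs_mul_cstE.
Qed.

Definition homogeneous p q (x : 'I_g) (X : 'M[series]_(p, q)) : Prop :=
  forall i j, spanw [:: x] (X i j).

Lemma homogeneousP p q x (X : 'M[series]_(p, q)) :
  homogeneous x X <-> (forall u, unzip1 u != [:: x] -> mxat X u = 0).
Proof.
split=> [Xx u ux|Xx i j].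
  by apply/matrixP => i j; rewrite !mxE; have /spanwP := Xx i j; apply.
by apply/spanwP => u /Xx /matrixP /(_ i j); rewrite !mxE.
Qed.

Lemma mxat_mul p q r x (X : 'M[series]_(p, q)) (Y : 'M[series]_(q, r)) u :
  homogeneous x X -> mxat (X *m Y) u =
    if u is t :: u' then mxat X [:: t] *m mxat Y u' else 0.
Proof.
move=> Xx; have supp i' h v : unzip1 v != [:: x] -> X i' h v = 0.
  by have /spanwP := Xx i' h; apply.
case: u => [|t u]; apply/matrixP => i j; rewrite !mxE series_sumE.
  by rewrite big1 // => h _; rewrite [LHS]ncs_mul_nil supp //; exact: mul0r.
apply: eq_bigr => h _; rewrite !mxE [LHS]ncs_mul_cons [X in X + _](_ : _ = 0); last first.
  by rewrite supp //; exact: mul0r.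
rewrite add0r -ncs_cst_mulE; congr (ncs_mul _ _ u); apply/funext => -[|t' v] //=.
by rewrite supp //= eqseq_cons andbF.
Qed.

Definition letters n (R : rep F m g n) : sys letter A n :=
  Sys (rc R) (fun t => mxat (rA R t.1) [:: t]) (rb R).

Definition linear_rep n (R : rep F m g n) : Prop := forall x, homogeneous x (rA R x).

Lemma mxat_rAw n (R : rep F m g n) w u : linear_rep R ->
  mxat (rAw R w) u = if unzip1 u == w then wordmx (sN (letters R)) u else 0.
Proof.
move=> linR; elim: w u => [|x w IH] u /=.
  case: u => [|t u] /=; apply/matrixP => i j; rewrite !mxE.
    by case: (i == j).
  by case: (i == j).
rewrite (mxat_mul _ _ (linR x)); case: u => [|t u] //=.
rewrite IH eqseq_cons; have [->|tx] := eqVneq t.1 x.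
  by case: (_ == _); rewrite /= ?mulmx0.
have /homogeneousP -> := linR x; first by rewrite mul0mx.
by rewrite /= eqseq_cons (negbTE tx).
Qed.

Lemma mxat_cAb n (R : rep F m g n) p q (u : 'M[A]_(p, n)) (v : 'M[A]_(n, q)) w s :
  linear_rep R ->
  mxat (cmx g u *m rAw R w *m cmx g v) s =
    if unzip1 s == w then u *m wordmx (sN (letters R)) s *m v else 0.
Proof.
move=> linR; rewrite mxat_cmxr mxat_cmxl mxat_rAw //.
by case: eqP => _; rewrite ?mulmx0 ?mul0mx.
Qed.

Lemma mxat_eq0 p q (X : 'M[series]_(p, q)) : (forall u, mxat X u = 0) -> X = 0.
Proof.
move=> X0; apply/matrixP => i j; apply/funext => u.
by have /matrixP/(_ i j) := X0 u; rewrite !mxE.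
Qed.

Lemma obsLE n (R : rep F m g n) (u : 'rV[A]_n) : linear_rep R ->
  obsL R u <-> unctr (letters R) u.
Proof.
move=> linR; split=> [uR s|uR w].
  have := mxat_cAb u (rb R) (unzip1 s) s linR; rewrite eqxx /= => <-.
  by rewrite uR; apply/matrixP => i j; rewrite !mxE.
by apply: mxat_eq0 => s; rewrite mxat_cAb //; case: eqP => // _.
Qed.

Lemma obsRE n (R : rep F m g n) (v : 'cV[A]_n) : linear_rep R ->
  obsR R v <-> unobs (letters R) v.
Proof.
move=> linR; split=> [vR s|vR w].
  have := mxat_cAb (rc R) v (unzip1 s) s linR; rewrite eqxx /= => <-.
  by rewrite vR; apply/matrixP => i j; rewrite !mxE.
by apply: mxat_eq0 => s; rewrite mxat_cAb //; case: eqP => // _.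
Qed.

Lemma representsE n (R : rep F m g n) S :
  represents R S <-> linear_rep R /\ forall u, S u = coef (letters R) u.
Proof.
split=> [[linR RS]|[linR RS]]; split=> //.
  move=> u; have := congr1 (fun V : series => V u) (RS (unzip1 u)).
  rewrite /scomp eqxx => ->.
  have /matrixP/(_ 0 0) := mxat_cAb (rc R) (rb R) (unzip1 u) u linR.
  by rewrite mxE => ->; rewrite eqxx.
move=> w; apply/funext => u; rewrite /scomp RS.
have /matrixP/(_ 0 0) := mxat_cAb (rc R) (rb R) w u linR.
by rewrite mxE => ->; case: eqP => // _; rewrite mxE.
Qed.

Definition compress_rep n k (P : 'M[A]_(k, n)) (Q : 'M[A]_(n, k)) (R : rep F m g n) :=
  Rep (rc R *m Q) (fun x => cmx g P *m rA R x *m cmx g Q) (P *m rb R).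

Lemma letters_compress n k (P : 'M[A]_(k, n)) (Q : 'M[A]_(n, k)) (R : rep F m g n) :
  letters (compress_rep P Q R) = compress P Q (letters R).
Proof.
by congr Sys; apply/funext => t; rewrite mxat_cmxr mxat_cmxl.
Qed.

Lemma linear_compress n k (P : 'M[A]_(k, n)) (Q : 'M[A]_(n, k)) (R : rep F m g n) :
  linear_rep R -> linear_rep (compress_rep P Q R).
Proof.
move=> linR x; apply/homogeneousP => u ux; rewrite mxat_cmxr mxat_cmxl.
by have /homogeneousP -> // := linR x; rewrite mulmx0 mul0mx.
Qed.

Lemma left_stepE k d (R : rep F m g (k + d)) (C : 'M[A]_(k, k + d))
    (B : 'M[A]_(d, k + d)) (Ui : 'M[A]_(k + d)) :
    max_lfree (obsL R) B -> inverse_mx (col_mx C B) Ui ->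
  step true R (compress_rep C (lsubmx Ui) R).
Proof.
move=> maxB invU; set R' := compress_rep _ _ _.
have -> : R' = Rep (lsubmx (rc R *m Ui))
    (fun x => ulsubmx (cmx g (col_mx C B) *m rA R x *m cmx g Ui))
    (usubmx (col_mx C B *m rb R)).
  rewrite /R' /compress_rep -(hsubmxK Ui).
  move: (lsubmx Ui) (rsubmx Ui) => Q E; rewrite row_mxKl mul_mx_row row_mxKl.
  rewrite mul_col_mx col_mxKu; congr Rep; apply/funext => x.
  by rewrite /cmx map_col_mx map_row_mx mul_col_mx mul_col_row block_mxKul.
apply: LeftStep => //; have [UV VU] := invU; split=> [a aU|u].
  by rewrite -[a]mulmx1 -UV mulmxA aU mul0mx.
by exists (u *m Ui); rewrite -mulmxA VU mulmx1.
Qed.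

Lemma right_stepE k d (R : rep F m g (k + d)) (C : 'M[A]_(k + d, k))
    (B : 'M[A]_(k + d, d)) (Vi : 'M[A]_(k + d)) :
    max_rfree (obsR R) B -> inverse_mx (row_mx C B) Vi ->
  step false R (compress_rep (usubmx Vi) C R).
Proof.
move=> maxB invV; set R' := compress_rep _ _ _.
have -> : R' = Rep (lsubmx (rc R *m row_mx C B))
    (fun x => ulsubmx (cmx g Vi *m rA R x *m cmx g (row_mx C B)))
    (usubmx (Vi *m rb R)).
  rewrite /R' /compress_rep -(vsubmxK Vi).
  move: (usubmx Vi) (dsubmx Vi) => P E; rewrite col_mxKu mul_col_mx col_mxKu.
  rewrite mul_mx_row row_mxKl; congr Rep; apply/funext => x.
  by rewrite /cmx map_row_mx map_col_mx mul_col_mx mul_col_row block_mxKul.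
apply: RightStep => //; have [UV VU] := invV; split=> [a aU|u].
  by rewrite -[a]mul1mx -VU -mulmxA aU mulmx0.
by exists (Vi *m u); rewrite mulmxA UV mul1mx.
Qed.

Lemma linear_step_left n (R : rep F m g n) S k :
    represents R S -> ctr_rank (letters R) (k * M) ->
  exists R' : rep F m g k, [/\ step true R R', represents R' S &
    forall s (u : 'M_(s, k)), unctr (letters R') u -> u = 0].
Proof.
move=> repS ctrk; have /representsE[linR coefR] := repS.
have [[q [ws rkk]] _] := ctrk.
have le_kn : (k <= n)%N.
  by rewrite -(@leq_pmul2r M) // -rkk rank_leq_row.
move: R repS ctrk linR coefR rkk.
rewrite -(subnKC le_kn); move: (n - k)%N => d R repS ctrk linR coefR rkk.
have [C [B [Ui [invU BZ Zspan]]]] := left_kernel_basis rkk.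
have uncB : unctr (letters R) B by apply/(unctrP _ ctrk rkk).
have spanB s (u : 'M_(s, k + d)) : unctr (letters R) u -> exists a, u = a *m B.
  by move/(unctrP _ ctrk rkk)/Zspan.
have [coefE ctrE] := left_step_sys invU uncB spanB.
exists (compress_rep C (lsubmx Ui) R); split.
- apply: left_stepE (invU); split=> [a aB|i|u].
  + have aE : row_mx (0 : 'rV_k) a = 0.
      rewrite -[LHS]mulmx1 -(proj1 invU) mulmxA mul_row_col.
      by rewrite aB mul0mx addr0 mul0mx.
    by rewrite -(row_mxKr (0 : 'rV_k) a) aE linear0.
  + apply/obsLE => // w; rewrite -!row_mul uncB; exact: row0.
  move=> /obsLE-/(_ linR) /spanB[a ->] free.
  have : row_mx a (- 1%:M) = 0 :> 'rV[A]_(d + 1).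
    by apply: free; rewrite mul_row_col mulNmx mul1mx subrr.
  move/(congr1 (fun X => rsubmx X 0 0)); rewrite row_mxKr !mxE /= => /eqP.
  by rewrite oppr_eq0 oner_eq0.
- apply/representsE; split; first exact: linear_compress.
  by move=> u; rewrite letters_compress coefE.
by move=> s u; rewrite letters_compress; apply: ctrE.
Qed.

(** A free module that is torsion is zero, so nothing is cut off when the
    representation is already reduced. *)
Lemma linear_step_right n (R : rep F m g n) S k :
    represents R S -> (forall s (u : 'M_(s, n)), unctr (letters R) u -> u = 0) ->
    obs_rank (letters R) (k * M) ->
  exists R' : rep F m g k, [/\ step false R R', represents R' S,
      totally_reduced R' &  reduced R -> k = n].
Proof.
move=> repS ctrR obsk; have /representsE[linR coefR] := repS.
have [[q [us rkk]] _] := obsk.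
have le_kn : (k <= n)%N.
  by rewrite -(@leq_pmul2r M) // -rkk rank_leq_col.
move: R repS ctrR obsk linR coefR rkk.
rewrite -(subnKC le_kn); move: (n - k)%N => d R repS ctrR obsk linR coefR rkk.
have [C [B [Vi [invV BZ Zspan]]]] := right_kernel_basis rkk.
have unoB : unobs (letters R) B by apply/(unobsP _ obsk rkk).
have spanB s (v : 'M_(k + d, s)) : unobs (letters R) v -> exists a, v = B *m a.
  by move/(unobsP _ obsk rkk)/Zspan.
have [coefE ctrE obsE] := right_step_sys invV unoB spanB ctrR.
have freeB s (a : 'M_(d, s)) : B *m a = 0 -> a = 0.
  move=> aB; have aE : col_mx (0 : 'M_(k, s)) a = 0.
    rewrite -[LHS]mul1mx -(proj2 invV) -mulmxA mul_row_col.
    by rewrite aB mulmx0 addr0 mulmx0.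
  by rewrite -(col_mxKd (0 : 'M_(k, s)) a) aE linear0.
have colB i : obsR R (col i B).
  by apply/obsRE => // w; rewrite colE mulmxA unoB mul0mx.
exists (compress_rep (usubmx Vi) C R); split.
- apply: right_stepE (invV); split=> // [a /freeB //|v].
  move=> /obsRE-/(_ linR) /spanB[a ->] free.
  have : col_mx a (- 1%:M) = 0 :> 'cV[A]_(d + 1).
    by apply: free; rewrite mul_row_col mulmxN mulmx1 subrr.
  move/(congr1 (fun X => dsubmx X 0 0)); rewrite col_mxKd !mxE /= => /eqP.
  by rewrite oppr_eq0 oner_eq0.
- apply/representsE; split; first exact: linear_compress.
  by move=> u; rewrite letters_compress coefE.
- have linR' := linear_compress (usubmx Vi) C linR.
  split=> [u /obsLE-/(_ linR')|v /obsRE-/(_ linR')]; rewrite letters_compress.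
    exact: ctrE.
  exact: obsE.
move=> [_ torsion]; case: (posnP d) => [->|d_gt0]; first by rewrite addn0.
have [a a0 Ba] := torsion _ (colB (Ordinal d_gt0)).
have /freeB/matrixP : B *m (delta_mx (Ordinal d_gt0) 0 *m a%:M) = 0 :> 'cV_(k + d).
  by rewrite mulmxA -colE.
move=> /(_ (Ordinal d_gt0) 0); rewrite !mxE big_ord1 !mxE !eqxx mul1r => /eqP.
by rewrite mulr1n (negbTE a0).
Qed.

Lemma totally_reduced_reduced n (R : rep F m g n) : totally_reduced R -> reduced R.
Proof.
case=> RL RR; split=> [u /RL ->|v /RR ->]; exists 1; rewrite ?oner_neq0 //.
  by rewrite scaler0.
by rewrite mul0mx.
Qed.

(** A left step makes the representation controllable, after which a right step
    divides by the unobservable states.  When the left step already gives a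
    reduced representation, the free module of unobservable states is torsion,
    hence zero. *)
Lemma reduction_exists n (R : rep F m g n) S k1 k2 :
    represents R S -> ctr_rank (letters R) (k1 * M) ->
    hankel_rank (letters R) (k2 * M) ->
  exists k (R' : rep F m g k), [/\ represents R' S, totally_reduced R' & reduction R R'].
Proof.
move=> repS ctrk hank.
have [R1 [step1 repS1 ctr1]] := linear_step_left repS ctrk.
have coef1 w : coef (letters R) w = coef (letters R1) w.
  have /representsE[_ <-] := repS; by have /representsE[_ <-] := repS1.
have obsk := hankel_obs_rank ctr1 (hankel_rank_coef coef1 hank).
have [R2 [step2 repS2 tot2 redE]] := linear_step_right repS1 ctr1 obsk.
have [red1|nred1] := pselect (reduced R1); last first.
  exists k2, R2; split=> //; apply: AltNext step1 nred1 _.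
  exact: AltStop step2 (totally_reduced_reduced tot2).
exists k1, R1; split=> //; last exact: AltStop step1 red1.
have /representsE[lin1 _] := repS1.
split=> [u /obsLE-/(_ lin1)/ctr1 //|v /obsRE-/(_ lin1) vR].
have [[q [us rkk]] _] := obsk.
have : \rank (flat (obsmx (letters R1) us)) = (k1 * M)%N by rewrite rkk redE.
move=> /eqP rkn; have := vR; move/(unobsP _ obsk rkk).
rewrite -[X in X = 0]trmxK trmx_mul => /(congr1 trmx); rewrite trmxK trmx0.
move/eqP; rewrite mulmx_free_eq0; last by rewrite /row_free mxrank_tr.
move/eqP/(congr1 trmx); rewrite trmxK trmx0 => vF.
by apply: flat_inj; rewrite vF flat0.
Qed.

End RepSystem.

(** * The standard construction over an arbitrary ring *)

Section Operations.
Variables (T : Type) (R : unitRingType).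

Definition onesys : sys T R 1 := Sys 1%:M (fun=> 0) 1%:M.

Definition scalesys n a (S : sys T R n) : sys T R n :=
  Sys (a *: sc S) (sN S) (sb S).

Definition addsys n1 n2 (S1 : sys T R n1) (S2 : sys T R n2) : sys T R (n1 + n2) :=
  Sys (row_mx (sc S1) (sc S2)) (fun t => block_mx (sN S1 t) 0 0 (sN S2 t))
      (col_mx (sb S1) (sb S2)).

Definition mulsys n1 n2 (S1 : sys T R n1) (S2 : sys T R n2) : sys T R (n1 + n2) :=
  Sys (row_mx (sc S1) (sc S1 *m sb S1 *m sc S2))
      (fun t => block_mx (sN S1 t) (sN S1 t *m (sb S1 *m sc S2)) 0 (sN S2 t))
      (col_mx 0 (sb S2)).

Definition invsys n (a : R) (S : sys T R n) : sys T R (n + 1) :=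
  Sys (row_mx (- (a^-1 *: sc S)) a^-1%:M)
      (fun t => block_mx (sN S t *m (1%:M - sb S *m a^-1%:M *m sc S))
                         (sN S t *m (sb S *m a^-1%:M)) 0 0)
      (col_mx 0 1%:M).

End Operations.
Arguments onesys {T R}.

Section Coefficients.
Variables (F : fieldType) (R : unitAlgType F) (T : Type).
Notation series := (ncseries T R).

Definition coefs n (S : sys T R n) (x : 'rV[R]_n) : series :=
  fun w => (x *m wordmx (sN S) w *m sb S) 0 0.

Lemma coefs_cons n (S : sys T R n) x t w : coefs S x (t :: w) = coefs S (x *m sN S t) w.
Proof. by rewrite /coefs /= !mulmxA. Qed.

Lemma coefsD n (S : sys T R n) x y : coefs S (x + y) = coefs S x + coefs S y.
Proof. by apply/funext => w; rewrite ncs_addE /coefs !mulmxDl mxE. Qed.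

Lemma coefsZ n (S : sys T R n) a x w : coefs S (a *: x) w = a * coefs S x w.
Proof. by rewrite /coefs -!scalemxAl mxE. Qed.

Lemma coef_one w : coef onesys w = (1 : series) w.
Proof.
case: w => [|t w]; first by rewrite /coef /= !mulmx1 mxE.
by rewrite /coef /= mul0mx mulmx0 mul0mx mxE.
Qed.

Lemma coef_scale n a (S : sys T R n) w : coef (scalesys a S) w = a * coef S w.
Proof. by rewrite /coef /= -!scalemxAl mxE. Qed.

Lemma coef_add n1 n2 (S1 : sys T R n1) (S2 : sys T R n2) w :
  coef (addsys S1 S2) w = coef S1 w + coef S2 w.
Proof.
suff sumE x y : coefs (addsys S1 S2) (row_mx x y) w = coefs S1 x w + coefs S2 y w.
  exact: sumE.
elim: w x y => [|t w IH] x y.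
  by rewrite /coefs /= !mulmx1 mul_row_col mxE.
rewrite coefs_cons /= mul_row_block !mulmx0 addr0 add0r IH.
by rewrite !coefs_cons.
Qed.

(** Extending a row [x] of the first system by [x *m sb S1 *m sc S2] lets the
    second system start wherever the first one may stop, which produces the
    convolution of the two series. *)
Lemma coefs_mul n1 n2 (S1 : sys T R n1) (S2 : sys T R n2) x w :
  coefs (mulsys S1 S2) (row_mx x (x *m sb S1 *m sc S2)) w =
  ncs_mul (coefs S1 x) (coef S2) w.
Proof.
have lower y u : coefs (mulsys S1 S2) (row_mx 0 y) u = coefs S2 y u.
  elim: u y => [|t u IH] y.
    by rewrite /coefs /= !mulmx1 mul_row_col mul0mx add0r.
  by rewrite !coefs_cons /= mul_row_block !mul0mx !add0r mulmx0 IH.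
elim: w x => [|t w IH] x.
  rewrite ncs_mul_nil /coef /coefs /= !mulmx1 mul_row_col mulmx0 add0r.
  by rewrite -(mulmxA (x *m sb S1)) [LHS]mxE big_ord1.
rewrite ncs_mul_cons coefs_cons /= mul_row_block mulmx0 addr0.
have -> : row_mx (x *m sN S1 t) (x *m (sN S1 t *m (sb S1 *m sc S2)) +
      x *m sb S1 *m sc S2 *m sN S2 t) =
    row_mx 0 (x *m sb S1 *m sc S2 *m sN S2 t) +
    row_mx (x *m sN S1 t) (x *m sN S1 t *m sb S1 *m sc S2).
  by rewrite add_row_mx add0r !mulmxA; congr row_mx; apply: addrC.
rewrite coefsD ncs_addE lower IH; congr (_ + _).
  rewrite /coef /coefs /= !mulmx1 -!(mulmxA (x *m sb S1)) [LHS]mxE big_ord1.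
  by rewrite !mulmxA.
by congr (ncs_mul _ _ w); apply/funext => u; rewrite coefs_cons.
Qed.

Lemma coef_mul n1 n2 (S1 : sys T R n1) (S2 : sys T R n2) w :
  coef (mulsys S1 S2) w = ((coef S1 : series) * (coef S2 : series)) w.
Proof. exact: (coefs_mul S1 S2 (sc S1)). Qed.

(** The rows [row_of x] are those reached after one letter; expanding along the
    first letter shows that they generate the products of series of [S] with
    the candidate inverse [V], whence [S * V = 1]. *)
Lemma coef_inv n a (S : sys T R n) w :
    coef S [::] = a -> a \is a GRing.unit ->
  coef (invsys a S) w = ((coef S : series)^-1) w.
Proof.
move=> Sa ua; pose V : series := coef (invsys a S).
have V0 : V [::] = a^-1.
  by rewrite /V /coef /= mulmx1 mul_row_col mulmx0 add0r mulmx1 mxE.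
pose row_of (x : 'rV_n) := row_mx (x *m (1%:M - sb S *m a^-1%:M *m sc S)) (x *m (sb S *m a^-1%:M)).
have rowN x t : row_of x *m sN (invsys a S) t =
    row_of (x *m (1%:M - sb S *m a^-1%:M *m sc S) *m sN S t).
  by rewrite /row_of /= mul_row_block !mulmx0 !addr0 !mulmxA.
have Vcons t u : V (t :: u) =
    coefs (invsys a S) (row_of (- (a^-1 *: sc S) *m sN S t)) u.
  by rewrite /V /coef -[LHS]/(coefs _ _ _) coefs_cons /= mul_row_block !mulmx0
     !addr0 /row_of !mulmxA.
have key u x : coefs (invsys a S) (row_of x) u = ncs_mul (coefs S x) V u.
  elim: u x => [|t u IH] x.
    rewrite ncs_mul_nil V0 {1}/coefs /= mulmx1 mul_row_col mulmx0 add0r mulmx1.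
    by rewrite mulmxA [LHS]mxE big_ord1 [a^-1%:M _ _]mxE mulr1n /coefs /= mulmx1.
  rewrite ncs_mul_cons coefs_cons rowN IH Vcons IH.
  have -> : (fun v => coefs S x (t :: v)) = coefs S (x *m sN S t).
    by apply/funext => v; rewrite coefs_cons.
  rewrite -ncs_cst_mulE.
  rewrite -[RHS]/((ncs_mul (ncs_cst (coefs S x [::]))
     (ncs_mul (coefs S (- (a^-1 *: sc S) *m sN S t)) V) +
     ncs_mul (coefs S (x *m sN S t)) V : series) u).
  rewrite ncs_mulA -ncs_mulDl; congr (ncs_mul _ V u).
  rewrite mulmxBr mulmx1 mulmxBl addrC coefsD; congr (_ + _).
  apply/funext => v; rewrite ncs_cst_mulE -coefsZ; congr (coefs S _ v).
  rewrite mulNmx scalerN -!mulmxA !scalemxAl; congr (- _).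
  have -> : coefs S x [::] *: (a^-1 *: sc S) = x *m (sb S *m (a^-1%:M *m sc S)).
    rewrite mul_scalar_mx mulmxA /coefs /= mulmx1.
    by rewrite [x *m sb S]mx11_scalar mul_scalar_mx mxE.
  by rewrite !mulmxA.
have SV : (coef S : series) * V = 1.
  apply/funext => -[|t u]; first by rewrite [LHS]ncs_mul_nil V0 Sa divrr.
  rewrite [LHS]ncs_mul_cons Vcons key Sa [RHS]/=.
  have -> : (fun v => coef S (t :: v)) = coefs S (sc S *m sN S t).
    by apply/funext => v; rewrite -coefs_cons.
  rewrite -ncs_cst_mulE.
  rewrite -[LHS]/((ncs_mul (ncs_cst a)
     (ncs_mul (coefs S (- (a^-1 *: sc S) *m sN S t)) V) +
     ncs_mul (coefs S (sc S *m sN S t)) V : series) u).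
  rewrite ncs_mulA -ncs_mulDl (_ : _ + _ = 0) ?[LHS](congr1 (fun f => f u) (mul0r V)) //.
  apply/funext => v; rewrite ncs_addE ncs_cst_mulE -coefsZ mulNmx -scalemxAl.
  by rewrite scalerN scalerA divrr // scale1r -scaleN1r coefsZ mulN1r addNr.
have uS : (coef S : series) \is a GRing.unit by rewrite ncs_unitE Sa.
by rewrite -[LHS]/(V w) -[V](mulKr uS) SV mulr1.
Qed.

End Coefficients.

Section Standard.
Variables (F : Type) (g : nat) (R : unitRingType) (s : F -> R) (v : 'I_g -> R).

Fixpoint value (r : ratexpr F g) : R :=
  match r with
  | ROne => 1
  | RVar i => v i
  | RScale k r1 => s k * value r1
  | RAdd r1 r2 => value r1 + value r2
  | RMul r1 r2 => value r1 * value r2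
  | RInv r1 => (value r1)^-1
  end.

Fixpoint defined (r : ratexpr F g) : bool :=
  match r with
  | ROne | RVar _ => true
  | RScale _ r1 => defined r1
  | RAdd r1 r2 | RMul r1 r2 => defined r1 && defined r2
  | RInv r1 => defined r1 && (value r1 \is a GRing.unit)
  end.

Fixpoint rdim (r : ratexpr F g) : nat :=
  match r with
  | ROne => 1
  | RVar _ => 1 + 1
  | RScale _ r1 => rdim r1
  | RAdd r1 r2 | RMul r1 r2 => rdim r1 + rdim r2
  | RInv r1 => rdim r1 + 1
  end.

Definition varsys (i : 'I_g) : sys 'I_g R (1 + 1) :=
  Sys (row_mx 1%:M (v i)%:M) (fun j => block_mx 0 (i == j)%:R%:M 0 0) (col_mx 0 1%:M).

(** In the standard construction every entry of [A^x] is a multiple [x * a], so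
    that one matrix over [R] for each variable suffices; [pull] below restores
    the coefficients on the left of the variables. *)
Fixpoint stdsys (r : ratexpr F g) : sys 'I_g R (rdim r) :=
  match r with
  | ROne => onesys
  | RVar i => varsys i
  | RScale k r1 => scalesys (s k) (stdsys r1)
  | RAdd r1 r2 => addsys (stdsys r1) (stdsys r2)
  | RMul r1 r2 => mulsys (stdsys r1) (stdsys r2)
  | RInv r1 => invsys (value r1) (stdsys r1)
  end.

End Standard.

Section Pull.
Variables (T T' : Type) (R : unitRingType) (h : T' -> R * T).

Definition pull n (S : sys T R n) : sys T' R n :=
  Sys (sc S) (fun t => (h t).1 *: sN S (h t).2) (sb S).

Lemma pull_one : pull onesys = onesys.
Proof. by congr Sys; apply/funext => t; rewrite /= scaler0. Qed.

Lemma pull_add n1 n2 (S1 : sys T R n1) (S2 : sys T R n2) :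
  pull (addsys S1 S2) = addsys (pull S1) (pull S2).
Proof. by congr Sys; apply/funext => t; rewrite /= scale_block_mx !scaler0. Qed.

Lemma pull_mul n1 n2 (S1 : sys T R n1) (S2 : sys T R n2) :
  pull (mulsys S1 S2) = mulsys (pull S1) (pull S2).
Proof.
by congr Sys; apply/funext => t; rewrite /= scale_block_mx !scaler0 scalemxAl.
Qed.

Lemma pull_inv n a (S : sys T R n) : pull (invsys a S) = invsys a (pull S).
Proof.
by congr Sys; apply/funext => t; rewrite /= scale_block_mx !scaler0 !scalemxAl.
Qed.

End Pull.

Section MapSys.
Variables (R R' : unitRingType) (f : {rmorphism R -> R'}).

Definition map_sys T n (S : sys T R n) : sys T R' n :=
  Sys (map_mx f (sc S)) (fun t => map_mx f (sN S t)) (map_mx f (sb S)).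

Variables (F F' : Type) (g : nat) (s : F -> R) (s' : F -> R').
Variables (v : 'I_g -> R) (v' : 'I_g -> R').
Hypotheses (fs : forall k, f (s k) = s' k) (fv : forall i, f (v i) = v' i).

Lemma map_value r : defined s v r ->
  defined s' v' r /\ value s' v' r = f (value s v r).
Proof.
elim: r => [|i|k r IH|r IHr q IHq|r IHr q IHq|r IH] //=.
- by rewrite rmorph1.
- by case/IH => -> ->; rewrite rmorphM fs.
- by case/andP => /IHr[-> ->] /IHq[-> ->]; rewrite rmorphD.
- by case/andP => /IHr[-> ->] /IHq[-> ->]; rewrite rmorphM.
by case/andP => /IH[-> ->] u; rewrite rmorph_unit // rmorphV.
Qed.

(** The standard construction commutes with ring morphisms: a point fixed by a
    semilinear automorphism of the matrix algebra gives a fixed system. *)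
Lemma map_stdsys r : defined s v r -> stdsys s' v' r = map_sys (stdsys s v r).
Proof.
elim: r => [|i|k r IH|r IHr q IHq|r IHr q IHq|r IH] /=.
- by move=> _; rewrite /map_sys /= map_mx1; congr Sys; apply/funext => t; rewrite map_mx0.
- move=> _; rewrite /map_sys /= map_row_mx map_mx1 map_scalar_mx /= fv.
  rewrite map_col_mx map_mx0 map_mx1; congr Sys; apply/funext => j.
  by rewrite map_block_mx !map_mx0 map_scalar_mx /= (rmorph_nat f).
- by move/IH => ->; rewrite /map_sys /scalesys /= map_mxZ fs.
- case/andP => /IHr -> /IHq ->; rewrite /map_sys /addsys /= map_row_mx map_col_mx.
  by congr Sys; apply/funext => t; rewrite map_block_mx !map_mx0.
- case/andP => /IHr -> /IHq ->; rewrite /map_sys /mulsys /= map_row_mx map_col_mx.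
  rewrite !map_mxM map_mx0; congr Sys; apply/funext => t.
  by rewrite map_block_mx !map_mxM map_mx0.
case/andP => dr u; rewrite IH // /map_sys /invsys /= map_row_mx map_col_mx.
have [_ ->] := map_value dr.
rewrite map_mx0 map_mx1 map_mxN map_mxZ map_scalar_mx /= rmorphV //.
congr Sys; apply/funext => t; rewrite map_block_mx !map_mx0 !map_mxM map_mxB.
by rewrite map_mx1 !map_mxM map_scalar_mx /= rmorphV.
Qed.

End MapSys.

Section StandardRep.
Variables (F : fieldType) (m g : nat).
Notation M := m.+1.
Notation A := 'M[F]_M.
Notation letter := ('I_g * ('I_M * 'I_M))%type.

Definition unit_letter (t : letter) : A * 'I_g := (delta_mx t.2.1 t.2.2, t.1).

Lemma value_rat_eval (r : ratexpr F g) (p : mxpoint F m g) :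
  value (fun k : F => k%:A) p r = rat_eval p r.
Proof.
by elim: r => //= [k r ->|r -> q ->|r -> q ->|r ->] //; rewrite mulr_algl.
Qed.

Lemma defined_rat_dom (r : ratexpr F g) (p : mxpoint F m g) :
  defined (fun k : F => k%:A) p r = rat_defined p r.
Proof.
by elim: r => //= [r -> q ->|r -> q ->|r ->] //; rewrite value_rat_eval.
Qed.

Lemma mxat_block p1 p2 q1 q2 (X : 'M[fpseries F m g]_(p1, q1)) Y Z W u :
  mxat (@block_mx _ p1 p2 q1 q2 X Y Z W) u =
  block_mx (mxat X u) (mxat Y u) (mxat Z u) (mxat W u).
Proof. exact: map_block_mx. Qed.

Lemma mxat0 p q u : mxat (0 : 'M[fpseries F m g]_(p, q)) u = 0.
Proof. by apply/matrixP => i j; rewrite !mxE. Qed.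

Lemma homogeneous0 p q x : homogeneous x (0 : 'M[fpseries F m g]_(p, q)).
Proof. by apply/homogeneousP => u _; rewrite mxat0. Qed.

Lemma homogeneous_block p1 p2 q1 q2 x (X : 'M[fpseries F m g]_(p1, q1)) Y Z W :
    homogeneous x X -> homogeneous x Y -> homogeneous x Z -> homogeneous x W ->
  homogeneous x (@block_mx _ p1 p2 q1 q2 X Y Z W).
Proof.
move=> /homogeneousP X0 /homogeneousP Y0 /homogeneousP Z0 /homogeneousP W0.
apply/homogeneousP => u ux; rewrite mxat_block X0 // Y0 // Z0 // W0 //.
exact: block_mx0.
Qed.

Lemma homogeneous_cmxr p q r x (X : 'M[fpseries F m g]_(p, q)) (P : 'M[A]_(q, r)) :
  homogeneous x X -> homogeneous x (X *m cmx g P).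
Proof.
by move=> /homogeneousP X0; apply/homogeneousP => u ux; rewrite mxat_cmxr X0 // mul0mx.
Qed.

Lemma letters_standard (r : ratexpr F g) (p : mxpoint F m g) : rat_dom m r p ->
  exists Rp : rep F m g (rdim r), [/\ standard r p = existT _ _ Rp, linear_rep Rp &
    letters Rp = pull unit_letter (stdsys (fun k : F => k%:A) p r)].
Proof.
elim: r => [|i|k r IH|r IHr q IHq|r IHr q IHq|r IH].
- move=> _; exists (rep_one F m g); split=> // [x|]; first exact: homogeneous0.
  by congr Sys; apply/funext => t; rewrite mxat0 scaler0.
- move=> _; exists (rep_var i (p i)); split=> // [x|].
    apply: homogeneous_block; try exact: homogeneous0.
    apply/homogeneousP => u ux; apply/matrixP => h j; rewrite !mxE !ord1 mulr1n.
    have [_|//] := eqVneq i x; case: u ux => [|[l [a b]] [|t u]] //=.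
    by rewrite eqseq_cons eqxx andbT => /negbTE ->; rewrite scale0r.
  congr Sys; apply/funext => -[x [a b]]; rewrite mxat_block scale_block_mx !mxat0.
  rewrite !scaler0; congr block_mx; apply/matrixP => h j; rewrite !mxE !ord1 /=.
  rewrite !mulr1n; have [_|_] := eqVneq i x; last by rewrite mulr0.
  by rewrite /= eqxx scale1r mulr1.
- case/IH => Rp [E lin lE]; exists (rep_scale k%:A Rp); rewrite /= E; split=> //.
  by rewrite -[RHS]/(scalesys k%:A (pull unit_letter (stdsys _ p r))) -lE.
- case/andP => /IHr[R1 [E1 lin1 l1]] /IHq[R2 [E2 lin2 l2]].
  exists (rep_add R1 R2); rewrite /= E1 E2 pull_add -l1 -l2; split=> // [x|].
    by apply: homogeneous_block => //; exact: homogeneous0.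
  by congr Sys; apply/funext => t; rewrite mxat_block !mxat0.
- case/andP => /IHr[R1 [E1 lin1 l1]] /IHq[R2 [E2 lin2 l2]].
  exists (rep_mul R1 R2); rewrite /= E1 E2 pull_mul -l1 -l2; split=> // [x|].
    by apply: homogeneous_block => //; [exact: homogeneous_cmxr|exact: homogeneous0].
  by congr Sys; apply/funext => t; rewrite mxat_block mxat0 mxat_cmxr.
case/andP => dr u; have [Rp [E lin lE]] := IH dr.
exists (rep_inv (expansion r p [::]) Rp); rewrite /= E pull_inv -lE; split=> // [x|].
  by apply: homogeneous_block; (exact: homogeneous_cmxr || exact: homogeneous0).
have [_ ->] := rat_defined_expansion dr; rewrite value_rat_eval.
by congr Sys; apply/funext => t; rewrite mxat_block !mxat0 !mxat_cmxr.
Qed.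

Lemma represents_standard (r : ratexpr F g) (p : mxpoint F m g) w : rat_dom m r p ->
  coef (pull unit_letter (stdsys (fun k : F => k%:A) p r)) w = expansion r p w.
Proof.
elim: r w => [|i|k r IH|r IHr q IHq|r IHr q IHq|r IH] w.
- by rewrite pull_one coef_one.
- move=> _; rewrite /expansion /= ncs_addE /coef /=.
  case: w => [|[l [a b]] [|t w]] /=.
  + rewrite mulmx1 mul_row_col mulmx0 add0r mulmx1 mxE eqxx mulr1n.
    by rewrite add0r.
  + rewrite [RHS]addr0 mulmx1 scale_block_mx !scaler0 mul_row_block !mulmx0 mul1mx.
    rewrite !addr0 mul_row_col mul0mx add0r mulmx1 !mxE eqxx mulr1n eq_sym.
    by case: (l == i); rewrite ?scale1r ?mulr1 ?scale0r ?mulr0.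
  rewrite [RHS]addr0 !scale_block_mx !scaler0 [X in row_mx _ _ *m X]mulmxA.
  rewrite mulmx_block !mul0mx !mulmx0 !addr0 (_ : block_mx _ _ _ _ = 0).
    by rewrite mul0mx mulmx0 mul0mx mxE.
  exact: block_mx0.
- move=> /(IH w) E; rewrite /expansion /= ncs_scaleE -/(expansion r p) -E -[RHS]mulr_algl.
  rewrite -[LHS]/(coef (scalesys k%:A (pull unit_letter (stdsys _ p r))) w).
  by rewrite (@coef_scale F).
- case/andP => dr dq; rewrite pull_add coef_add (IHr _ dr) (IHq _ dq).
  by [].
- case/andP => dr dq; rewrite pull_mul coef_mul; congr ((_ * _ : ncseries _ _) w).
    by apply/funext => u; apply: IHr.
  by apply/funext => u; apply: IHq.
case/andP => dr u; have E : coef (pull unit_letter (stdsys (fun k : F => k%:A) p r)) =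
    expansion r p by apply/funext => x; apply: IH.
have [_ val] := rat_defined_expansion dr.
rewrite /= pull_inv (@coef_inv F) ?E ?value_rat_eval //.
Qed.

End StandardRep.

(** * Regular families of matrices and semicontinuity of their rank *)

Section Regular.
Variables (F : fieldType) (m g : nat).
Notation M := m.+1.
Notation N := #|{: 'I_g * ('I_M * 'I_M)}|.
Notation pol := (mpoly.mpoly N F).

Notation peval iota p := (mmap iota (pt_coord p)).

Lemma pevalC (K : fieldType) (iota : {rmorphism F -> K}) (p : mxpoint K m g) c :
  peval iota p (mpolyC N c) = iota c.
Proof. by rewrite mmapC. Qed.

Lemma pevalX (K : fieldType) (iota : {rmorphism F -> K}) (p : mxpoint K m g) k i j :
  peval iota p (mpolyX F (mnm1 (enum_rank (k, (i, j))))) = p k i j.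
Proof. by rewrite mmapX mmap1U /pt_coord enum_rankK. Qed.

Definition domain := forall (K : fieldType) (iota : {rmorphism F -> K}),
  mxpoint K m g -> bool.

Definition family (X : fieldType -> Type) := forall (K : fieldType)
  (iota : {rmorphism F -> K}), mxpoint K m g -> X K.

(** Fractions over [F] that are evaluated at the points over all extensions of
    [F] at once: this lets a rank be compared at points over different fields. *)
Definition regular (D : domain) (f : family (fun K => K)) : Prop :=
  exists num den : pol, forall K iota p, D K iota p ->
    peval iota p den != 0 /\ f K iota p = peval iota p num / peval iota p den.

Definition regular_mx (D : domain) a b (X : family (fun K => 'M[K]_(a, b))) : Prop :=
  forall i j, regular D (fun K iota p => X K iota p i j).

Definition regular_mx2 (D : domain) a b
    (X : family (fun K => 'M['M[K]_M]_(a, b))) : Prop :=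
  forall i j, regular_mx D (fun K iota p => X K iota p i j).

Section Closure.
Variable D : domain.
Arguments D : clear implicits.

Lemma regular_ext f f' : (forall K iota p, D K iota p -> f K iota p = f' K iota p) ->
  regular D f -> regular D f'.
Proof.
by move=> ff [n [d H]]; exists n, d => K iota p Dp; rewrite -ff //; apply: H.
Qed.

Lemma regular_const c : regular D (fun K iota p => iota c).
Proof.
exists (mpolyC N c), 1 => K iota p _.
by rewrite pevalC rmorph1 oner_neq0 divr1.
Qed.

Lemma regular_nat n : regular D (fun K iota p => n%:R).
Proof. by apply: regular_ext (regular_const n%:R) => K iota p _; rewrite rmorph_nat. Qed.

Lemma regular_sign n : regular D (fun K iota p => (-1) ^+ n).
Proof.
apply: regular_ext (regular_const ((-1) ^+ n)) => K iota p _.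
by rewrite rmorphXn rmorphN1.
Qed.

Lemma regular_coord k i j : regular D (fun K iota p => p k i j).
Proof.
exists (mpolyX F (mnm1 (enum_rank (k, (i, j))))), 1 => K iota p _.
by rewrite pevalX rmorph1 oner_neq0 divr1.
Qed.

Lemma regularD f f' : regular D f -> regular D f' ->
  regular D (fun K iota p => f K iota p + f' K iota p).
Proof.
move=> [n [d H]] [n' [d' H']]; exists (n * d' + n' * d), (d * d') => K iota p Dp.
have [d0 ->] := H K iota p Dp; have [d0' ->] := H' K iota p Dp.
by rewrite rmorphD !rmorphM mulf_neq0 // addf_div.
Qed.

Lemma regularM f f' : regular D f -> regular D f' ->
  regular D (fun K iota p => f K iota p * f' K iota p).
Proof.
move=> [n [d H]] [n' [d' H']]; exists (n * n'), (d * d') => K iota p Dp.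
have [d0 ->] := H K iota p Dp; have [d0' ->] := H' K iota p Dp.
by rewrite !rmorphM mulf_neq0 // mulf_div.
Qed.

Lemma regularN f : regular D f -> regular D (fun K iota p => - f K iota p).
Proof.
move=> rf; apply: regular_ext (regularM (regular_const (-1)) rf) => K iota p _.
by rewrite rmorphN1 mulN1r.
Qed.

Lemma regularV f : (forall K iota p, D K iota p -> f K iota p != 0) ->
  regular D f -> regular D (fun K iota p => (f K iota p)^-1).
Proof.
move=> f0 [n [d H]]; exists d, n => K iota p Dp.
have := f0 K iota p Dp; have [d0 ->] := H K iota p Dp.
by rewrite mulf_eq0 negb_or => /andP[n0 _]; rewrite invf_div.
Qed.

Lemma regular_sum (I : Type) (r : seq I) (f : I -> family (fun K => K)) :
  (forall i, regular D (f i)) ->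
  regular D (fun K iota p => \sum_(i <- r) f i K iota p).
Proof.
move=> rf; elim: r => [|i r IH].
  by apply: regular_ext (regular_nat 0) => K iota p _; rewrite big_nil.
by apply: regular_ext (regularD (rf i) IH) => K iota p _; rewrite big_cons.
Qed.

Lemma regular_prod (I : Type) (r : seq I) (f : I -> family (fun K => K)) :
  (forall i, regular D (f i)) ->
  regular D (fun K iota p => \prod_(i <- r) f i K iota p).
Proof.
move=> rf; elim: r => [|i r IH].
  by apply: regular_ext (regular_nat 1) => K iota p _; rewrite big_nil.
by apply: regular_ext (regularM (rf i) IH) => K iota p _; rewrite big_cons.
Qed.

Lemma regular_det n (X : family (fun K => 'M[K]_n)) : regular_mx D X ->
  regular D (fun K iota p => \det (X K iota p)).
Proof.
move=> rX; apply: regular_sum => s; apply: regularM; first exact: regular_sign.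
by apply: regular_prod => i; apply: rX.
Qed.

Lemma regular_mxM a b c (X : family (fun K => 'M[K]_(a, b)))
    (Y : family (fun K => 'M[K]_(b, c))) :
  regular_mx D X -> regular_mx D Y ->
  regular_mx D (fun K iota p => X K iota p *m Y K iota p).
Proof.
move=> rX rY i j; apply: regular_ext; last first.
  apply: (regular_sum (index_enum 'I_b)) => h.
  exact: regularM (rX i h) (rY h j).
by move=> K iota p _; rewrite mxE.
Qed.

Lemma regular_mxD a b (X Y : family (fun K => 'M[K]_(a, b))) :
  regular_mx D X -> regular_mx D Y ->
  regular_mx D (fun K iota p => X K iota p + Y K iota p).
Proof.
move=> rX rY i j; apply: regular_ext (regularD (rX i j) (rY i j)).
by move=> K iota p _; rewrite mxE.
Qed.

Lemma regular_mxN a b (X : family (fun K => 'M[K]_(a, b))) :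
  regular_mx D X -> regular_mx D (fun K iota p => - X K iota p).
Proof.
move=> rX i j; apply: regular_ext (regularN (rX i j)).
by move=> K iota p _; rewrite mxE.
Qed.

Lemma regular_mx0 a b : regular_mx D (fun K iota p => 0 : 'M[K]_(a, b)).
Proof. by move=> i j; apply: regular_ext (regular_nat 0) => K iota p _; rewrite mxE. Qed.

Lemma regular_mx_scalar n f : regular D f ->
  regular_mx D (fun K iota p => (f K iota p)%:M : 'M[K]_n).
Proof.
move=> rf i j; apply: regular_ext (regularM rf (regular_nat (i == j))).
by move=> K iota p _; rewrite mxE mulr_natr.
Qed.

Lemma regular_mx_sum (I : Type) (r : seq I) a b (X : I -> family (fun K => 'M[K]_(a, b))) :
  (forall i, regular_mx D (X i)) ->
  regular_mx D (fun K iota p => \sum_(i <- r) X i K iota p).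
Proof.
move=> rX i j; apply: regular_ext; last exact: (regular_sum r (fun h => rX h i j)).
by move=> K iota p _; rewrite summxE.
Qed.

(** Cramer's rule reduces inverses to determinants. *)
Lemma regular_mxV (X : family (fun K => 'M[K]_M)) :
    (forall K iota p, D K iota p -> X K iota p \is a GRing.unit) ->
  regular_mx D X -> regular_mx D (fun K iota p => (X K iota p)^-1).
Proof.
move=> uX rX i j; apply: (@regular_ext (fun K iota p =>
    (\det (X K iota p))^-1 * \adj (X K iota p) i j)).
  move=> K iota p Dp; rewrite -[(X K iota p)^-1]/(invmx _) /invmx.
  by rewrite -[_ \in _]/(X K iota p \is a GRing.unit) uX // [RHS]mxE.
apply: regularM.
  apply: regularV (regular_det rX) => K iota p /uX.
  by rewrite -unitfE.
apply: (@regular_ext (fun K iota p => (-1) ^+ (j + i) *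
    \det (row' j (col' i (X K iota p))))).
  by move=> K iota p _; rewrite mxE.
apply: regularM; first exact: regular_sign.
apply: regular_det => h l; apply: regular_ext (rX (lift j h) (lift i l)).
by move=> K iota p _; rewrite !mxE.
Qed.

Lemma regular_mx2M a b c (X : family (fun K => 'M['M[K]_M]_(a, b)))
    (Y : family (fun K => 'M['M[K]_M]_(b, c))) :
  regular_mx2 D X -> regular_mx2 D Y ->
  regular_mx2 D (fun K iota p => X K iota p *m Y K iota p).
Proof.
move=> rX rY i j h l; have := regular_mx_sum (index_enum 'I_b)
  (fun k => regular_mxM (rX i k) (rY k j)).
by move/(_ h l); apply: regular_ext => K iota p _; rewrite mxE.
Qed.

Lemma regular_mx2D a b (X Y : family (fun K => 'M['M[K]_M]_(a, b))) :
  regular_mx2 D X -> regular_mx2 D Y ->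
  regular_mx2 D (fun K iota p => X K iota p + Y K iota p).
Proof.
move=> rX rY i j h l; apply: regular_ext (regular_mxD (rX i j) (rY i j) h l).
by move=> K iota p _; rewrite [in RHS]mxE.
Qed.

Lemma regular_mx2N a b (X : family (fun K => 'M['M[K]_M]_(a, b))) :
  regular_mx2 D X -> regular_mx2 D (fun K iota p => - X K iota p).
Proof.
move=> rX i j h l; apply: regular_ext (regular_mxN (rX i j) h l).
by move=> K iota p _; rewrite [in RHS]mxE.
Qed.

Lemma regular_mx2_0 a b : regular_mx2 D (fun K iota p => 0 : 'M['M[K]_M]_(a, b)).
Proof.
move=> i j h l; apply: regular_ext (regular_mx0 h l) => K iota p _.
by rewrite [in RHS]mxE.
Qed.

Lemma regular_mx2Z a b (f : family (fun K => 'M[K]_M))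
    (X : family (fun K => 'M['M[K]_M]_(a, b))) :
  regular_mx D f -> regular_mx2 D X ->
  regular_mx2 D (fun K iota p => f K iota p *: X K iota p).
Proof.
move=> rf rX i j h l; apply: regular_ext (regular_mxM rf (rX i j) h l).
by move=> K iota p _; rewrite [in RHS]mxE.
Qed.

Lemma regular_mx2_scalar n (f : family (fun K => 'M[K]_M)) : regular_mx D f ->
  regular_mx2 D (fun K iota p => (f K iota p)%:M : 'M['M[K]_M]_n).
Proof.
move=> rf i j h l; apply: regular_ext (regularM (rf h l) (regular_nat (i == j))).
move=> K iota p _; rewrite [in RHS]mxE; case: (i == j); rewrite ?mulr1 ?mulr1n //.
by rewrite mulr0 mulr0n mxE.
Qed.

Lemma regular_mx2_1 n : regular_mx2 D (fun K iota p => 1%:M : 'M['M[K]_M]_n).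
Proof.
apply: regular_mx2_scalar => h l; apply: regular_ext (regular_nat (h == l)).
by move=> K iota p _; rewrite mxE.
Qed.

Lemma regular_mx2_row a b c (X : family (fun K => 'M['M[K]_M]_(a, b)))
    (Y : family (fun K => 'M['M[K]_M]_(a, c))) :
  regular_mx2 D X -> regular_mx2 D Y ->
  regular_mx2 D (fun K iota p => row_mx (X K iota p) (Y K iota p)).
Proof.
move=> rX rY i j h l; case: (splitP j) => k jk.
  by apply: regular_ext (rX i k h l) => K iota p _;
     rewrite (_ : j = lshift _ k) ?row_mxEl //; apply: val_inj.
by apply: regular_ext (rY i k h l) => K iota p _;
   rewrite (_ : j = rshift _ k) ?row_mxEr //; apply: val_inj.
Qed.

Lemma regular_mx2_col a b c (X : family (fun K => 'M['M[K]_M]_(a, b)))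
    (Y : family (fun K => 'M['M[K]_M]_(c, b))) :
  regular_mx2 D X -> regular_mx2 D Y ->
  regular_mx2 D (fun K iota p => col_mx (X K iota p) (Y K iota p)).
Proof.
move=> rX rY i j h l; case: (splitP i) => k ik.
  by apply: regular_ext (rX k j h l) => K iota p _;
     rewrite (_ : i = lshift _ k) ?col_mxEu //; apply: val_inj.
by apply: regular_ext (rY k j h l) => K iota p _;
   rewrite (_ : i = rshift _ k) ?col_mxEd //; apply: val_inj.
Qed.

Lemma regular_flat a b (X : family (fun K => 'M['M[K]_M]_(a, b))) :
  regular_mx2 D X -> regular_mx D (fun K iota p => flat (X K iota p)).
Proof.
move=> rX i j; apply: regular_ext (rX (unindex i).1 (unindex j).1 _ _).
by move=> K iota p _; rewrite mxE.
Qed.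

End Closure.

Lemma regular_sub (D D' : domain) f : (forall K iota p, D' K iota p -> D K iota p) ->
  regular D f -> regular D' f.
Proof. by move=> DD [n [d H]]; exists n, d => K iota p /DD; apply: H. Qed.

Definition regular_sys (D : domain) T n
    (S : family (fun K => sys T 'M[K]_M n)) : Prop :=
  [/\ regular_mx2 D (fun K iota p => sc (S K iota p)),
      forall t, regular_mx2 D (fun K iota p => sN (S K iota p) t) &
      regular_mx2 D (fun K iota p => sb (S K iota p))].

Lemma regular_sys_sub (D D' : domain) T n (S : family (fun K => sys T 'M[K]_M n)) :
  (forall K iota p, D' K iota p -> D K iota p) ->
  regular_sys D S -> regular_sys D' S.
Proof.
move=> DD [rc rN rb]; split=> [i j h l|t i j h l|i j h l]; apply: (regular_sub DD).
- exact: rc.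
- exact: rN.
exact: rb.
Qed.

Definition rat_domain (r : ratexpr F g) : domain :=
  fun K iota p => defined (fun k : F => (iota k)%:M : 'M[K]_M) p r.
Arguments rat_domain r K iota p : clear implicits.

Definition value_at (r : ratexpr F g) : family (fun K => 'M[K]_M) :=
  fun K iota p => value (fun k : F => (iota k)%:M : 'M[K]_M) p r.
Arguments value_at r K iota p : clear implicits.

Definition std_at (r : ratexpr F g) : family (fun K => sys 'I_g 'M[K]_M (rdim r)) :=
  fun K iota p => stdsys (fun k : F => (iota k)%:M : 'M[K]_M) p r.
Arguments std_at r K iota p : clear implicits.

Lemma regular_value r : regular_mx (rat_domain r) (value_at r).
Proof.
have sub (D D' : domain) a b (X : family (fun K => 'M[K]_(a, b))) :
    (forall K iota p, D' K iota p -> D K iota p) ->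
    regular_mx D X -> regular_mx D' X.
  by move=> DD rX i j; apply: regular_sub DD (rX i j).
rewrite /rat_domain /value_at; elim: r => [|i|k r IH|r IHr q IHq|r IHr q IHq|r IH] /=.
- exact: (regular_mx_scalar (f := fun K _ _ => 1) (regular_nat _ 1)).
- by move=> h l; apply: regular_coord.
- apply: regular_mxM => //; apply: (regular_mx_scalar (f := fun K iota _ => iota k)).
  exact: regular_const.
- by apply: regular_mxD; [apply: sub IHr|apply: sub IHq] => K iota p /andP[].
- by apply: regular_mxM; [apply: sub IHr|apply: sub IHq] => K iota p /andP[].
apply: (regular_mxV (X := value_at r)) => [K iota p /andP[] //|].
by apply: sub IH => K iota p /andP[].
Qed.

(** An inverse occurring in [r] cuts out of the domain the zeros of a numerator
    of the determinant of the inverted value. *)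
Lemma rat_domain_basic r : exists del : pol, forall K iota p,
  rat_domain r K iota p = (peval iota p del != 0).
Proof.
elim: r => [|i|k r IH|r [dr Hr] q [dq Hq]|r [dr Hr] q [dq Hq]|r [dr Hr]] //.
- by exists 1 => K iota p; rewrite rmorph1 oner_neq0.
- by exists 1 => K iota p; rewrite rmorph1 oner_neq0.
- by exists (dr * dq) => K iota p; rewrite rmorphM mulf_eq0 negb_or -Hr -Hq.
- by exists (dr * dq) => K iota p; rewrite rmorphM mulf_eq0 negb_or -Hr -Hq.
have [n [d H]] := regular_det (@regular_value r).
exists (dr * n) => K iota p; rewrite rmorphM mulf_eq0 negb_or -Hr.
rewrite -[LHS]/(rat_domain r K iota p && (value_at r K iota p \in unitmx)).
case Dp: (rat_domain r K iota p) => //=.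
have [d0 E] := H K iota p Dp.
by rewrite unitmxE unitfE E mulf_eq0 invr_eq0 negb_or d0 andbT.
Qed.

Lemma regular_std r : regular_sys (rat_domain r) (std_at r).
Proof.
rewrite /rat_domain /std_at; elim: r => [|i|k r IH|r IHr q IHq|r IHr q IHq|r IH] /=.
- split=> [|t|]; [exact: regular_mx2_1|exact: regular_mx2_0|exact: regular_mx2_1].
- split=> [|t|] /=.
  + apply: regular_mx2_row; first exact: regular_mx2_1.
    by apply: regular_mx2_scalar => h l; apply: regular_coord.
  + apply: regular_mx2_col; apply: regular_mx2_row; try exact: regular_mx2_0.
    apply: (regular_mx2_scalar (f := fun K _ _ => (i == t)%:R)) => h l.
    apply: regular_ext (regularM (regular_nat _ (i == t)) (regular_nat _ (h == l))).
    by move=> K iota p _; case: (i == t); rewrite ?mulr1n ?mulr0n mxE ?mul1r ?mul0r.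
  by apply: regular_mx2_col; [exact: regular_mx2_0|exact: regular_mx2_1].
- have [rc rN rb] := IH; split=> //=; apply: regular_mx2Z => //.
  apply: (regular_mx_scalar (f := fun K iota _ => iota k)).
  exact: regular_const.
- have [rc rN rb] : regular_sys (rat_domain (RAdd r q)) (std_at r).
    by apply: regular_sys_sub IHr => K iota p /andP[].
  have [rc' rN' rb'] : regular_sys (rat_domain (RAdd r q)) (std_at q).
    by apply: regular_sys_sub IHq => K iota p /andP[].
  split=> [|t|]; [exact: regular_mx2_row| |exact: regular_mx2_col].
  by apply: regular_mx2_col; apply: regular_mx2_row => //; exact: regular_mx2_0.
- have [rc rN rb] : regular_sys (rat_domain (RMul r q)) (std_at r).
    by apply: regular_sys_sub IHr => K iota p /andP[].
  have [rc' rN' rb'] : regular_sys (rat_domain (RMul r q)) (std_at q).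
    by apply: regular_sys_sub IHq => K iota p /andP[].
  split=> [|t|].
  + apply: regular_mx2_row => //; apply: regular_mx2M => //; exact: regular_mx2M.
  + apply: regular_mx2_col; apply: regular_mx2_row => //; last exact: regular_mx2_0.
    by apply: regular_mx2M => //; apply: regular_mx2M.
  by apply: regular_mx2_col => //; exact: regular_mx2_0.
have [rc rN rb] : regular_sys (rat_domain (RInv r)) (std_at r).
  by apply: regular_sys_sub IH => K iota p /andP[].
have rV : regular_mx (rat_domain (RInv r)) (fun K iota p => (value_at r K iota p)^-1).
  apply: regular_mxV => [K iota p /andP[] //|h l].
  by apply: (regular_sub _ (@regular_value r h l)) => K iota p /andP[].
have rbVc := regular_mx2M (regular_mx2M rb (@regular_mx2_scalar _ 1 _ rV)) rc.
split=> [|t|].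
- apply: regular_mx2_row; last exact: regular_mx2_scalar.
  by apply: regular_mx2N; apply: regular_mx2Z.
- apply: regular_mx2_col; apply: regular_mx2_row; try exact: regular_mx2_0.
    apply: regular_mx2M => //; apply: regular_mx2D; first exact: regular_mx2_1.
    exact: regular_mx2N.
  by apply: regular_mx2M => //; apply: regular_mx2M => //; exact: regular_mx2_scalar.
by apply: regular_mx2_col; [exact: regular_mx2_0|exact: regular_mx2_1].
Qed.

Lemma regular_wordmx D T n (S : family (fun K => sys T 'M[K]_M n)) w :
  regular_sys D S -> regular_mx2 D (fun K iota p => wordmx (sN (S K iota p)) w).
Proof.
case=> _ rN _; elim: w => [|t w IH] /=; first exact: regular_mx2_1.
exact: regular_mx2M.
Qed.

Lemma regular_obsmx D T n (S : family (fun K => sys T 'M[K]_M n)) q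
    (us : 'I_q -> seq T) :
  regular_sys D S -> regular_mx2 D (fun K iota p => obsmx (S K iota p) us).
Proof.
move=> rS i j h l; have [rc _ _] := rS.
apply: regular_ext (regular_mx2M rc (regular_wordmx (us i) rS) 0 j h l).
by move=> K iota p _; rewrite [in RHS]mxE.
Qed.

Lemma regular_ctrmx D T n (S : family (fun K => sys T 'M[K]_M n)) q
    (us : 'I_q -> seq T) :
  regular_sys D S -> regular_mx2 D (fun K iota p => ctrmx (S K iota p) us).
Proof.
move=> rS i j h l; have [_ _ rb] := rS.
apply: regular_ext (regular_mx2M (regular_wordmx (us j) rS) rb i 0 h l).
by move=> K iota p _; rewrite [in RHS]mxE.
Qed.

Lemma regular_letters r : regular_sys (rat_domain r)
  (fun K iota p => pull (@unit_letter K m g) (std_at r K iota p)).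
Proof.
have [rc rN rb] := regular_std r; split=> // t; apply: regular_mx2Z; last exact: rN.
move=> h l.
apply: regular_ext (regular_nat _ ((h == t.2.1) && (l == t.2.2))).
by move=> K iota p _; rewrite mxE.
Qed.

(** Full-rank minors are regular, so that a rank can only grow under
    generization. *)
Lemma rank_semicontinuous r a b (X : family (fun K => 'M[K]_(a, b))) :
    regular_mx (rat_domain r) X ->
  forall K iota p, rat_domain r K iota p -> exists q : pol,
    peval iota p q != 0 /\ forall (K' : fieldType) (iota' : {rmorphism F -> K'})
        (p' : mxpoint K' m g),
      peval iota' p' q != 0 ->
      rat_domain r K' iota' p' /\ (\rank (X K iota p) <= \rank (X K' iota' p'))%N.
Proof.
move=> rX K iota p Dp; set h := \rank (X K iota p).
pose f := maxrankfun (X K iota p).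
have free_f : row_full (rowsub f (X K iota p))^T.
  by rewrite /row_full mxrank_tr; apply: maxrowsub_free.
pose e := fullrankfun free_f.
have minor : \det (mxsub f e (X K iota p)) != 0.
  have := fullrowsub_unit free_f; rewrite unitmxE unitfE -det_tr.
  by rewrite (_ : _^T = mxsub f e (X K iota p)) //; apply/matrixP => i j; rewrite !mxE.
have rmin : regular_mx (rat_domain r) (fun K iota p => mxsub f e (X K iota p)).
  move=> i j; apply: regular_ext (rX (f i) (e j)).
  by move=> K' iota' p' _; rewrite mxE.
have [n [d H]] := regular_det rmin.
have [del delE] := rat_domain_basic r.
exists (del * n); split=> [|K' iota' p'].
  have [d0 E] := H _ _ _ Dp; rewrite rmorphM mulf_neq0 -?delE //.
  by move: minor; rewrite E; apply: contraNneq => ->; rewrite mul0r.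
rewrite rmorphM mulf_eq0 negb_or -delE => /andP[Dp' n0]; split=> //.
have [d0 E] := H _ _ _ Dp'.
have minor' : mxsub f e (X K' iota' p') \in unitmx.
  by rewrite unitmxE unitfE E mulf_neq0 ?invr_eq0.
have <- : \rank (mxsub f e (X K' iota' p')) = h by rewrite mxrank_unit.
have -> : mxsub f e (X K' iota' p') = (rowsub e (rowsub f (X K' iota' p'))^T)^T.
  by apply/matrixP => i j; rewrite !mxE.
rewrite mxrank_tr (leq_trans (mxrankS (rowsub_sub _ _))) // mxrank_tr.
exact: mxrankS (rowsub_sub _ _).
Qed.

End Regular.

Arguments rat_domain {F m g} r K iota p.
Arguments value_at {F m g} r K iota p.
Arguments std_at {F m g} r K iota p.

(** * Points of polynomials and fields of fractions *)

Section MpolyPoints.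
Variables (F : fieldType) (n : nat).
Implicit Type q : mpoly.mpoly n F.

Lemma mmap_rmorph (R S : comNzRingType) (f : {rmorphism F -> R}) (h : {rmorphism R -> S})
    (a : 'I_n -> R) q :
  h (mmap f a q) = mmap (h \o f) (h \o a) q.
Proof.
rewrite /mmap rmorph_sum; apply: eq_bigr => k _; rewrite rmorphM; congr (_ * _).
by rewrite /mmap1 rmorph_prod; apply: eq_bigr => i _; rewrite rmorphXn.
Qed.

Lemma eq_mmap (R : comNzRingType) (f f' : F -> R) (a a' : 'I_n -> R) q :
  f =1 f' -> a =1 a' -> mmap f a q = mmap f' a' q.
Proof.
move=> ff aa; rewrite /mmap; apply: eq_bigr => k _; rewrite ff; congr (_ * _).
by apply: eq_bigr => i _; rewrite aa.
Qed.

Lemma mmap_variables q : mmap (mpolyC n (R:=F)) (fun i => mpolyX F (mnm1 i)) q = q.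
Proof.
rewrite {2}[q]mpolyE /mmap; apply: eq_bigr => k _.
by rewrite mmap1_id mul_mpolyC.
Qed.

Lemma char0_nat_inj (R : nzRingType) (f : {rmorphism F -> R}) :
  [pchar F] =i pred0 -> injective (fun k : nat => k%:R : R).
Proof.
move=> char0 k l; wlog le_kl : k l / (k <= l)%N.
  by move=> H e; case: (leqP k l) => [|/ltnW] /H ->.
move/eqP; rewrite -subr_eq0 -opprB oppr_eq0 -natrB // => /eqP lk0.
apply/eqP; rewrite eqn_leq le_kl /= -subn_eq0.
have /pcharf0P <- := char0; rewrite -(fmorph_eq0 f) rmorph_nat lk0 eqxx //.
Qed.

(** The variables are specialized one at a time to natural numbers that are not
    roots of the polynomial in the current variable. *)
Lemma nonzero_value q : [pchar F] =i pred0 -> q != 0 ->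
  exists b : 'I_n -> F, meval b q != 0.
Proof.
move=> char0 q0; pose R := mpoly.mpoly n F.
pose pt (s : seq 'I_n) (b : 'I_n -> F) i : R :=
  if i \in s then mpolyC n (b i) else mpolyX F (mnm1 i).
have [b] : exists b, mmap (mpolyC n (R:=F)) (pt (enum 'I_n) b) q != 0.
  elim: (enum _) => [|i s [b Hb]].
    by exists (fun=> 0); rewrite /pt mmap_variables.
  pose a j : {poly R} := if j == i then 'X else (pt s b j)%:P.
  pose P := mmap (polyC \o mpolyC n (R:=F)) a q.
  have PE z : P.[z] = mmap (mpolyC n (R:=F)) (fun j => if j == i then z else pt s b j) q.
    rewrite -[LHS]/(horner_eval z P) mmap_rmorph; apply: eq_mmap => j /=.
      by rewrite /horner_eval hornerC.
    by rewrite /a /horner_eval; case: (j == i); rewrite ?hornerX ?hornerC.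
  have P0 : P != 0.
    apply: contraNneq Hb => P0; have := PE (pt s b i); rewrite P0 horner0 => /esym/eqP.
    by congr (_ == 0); apply: eq_mmap => // j; case: eqP => [->|].
  have [t Pt] : exists t : nat, P.[t%:R] != 0.
    apply: contrapT => noroot; pose rs := [seq (t%:R : R) | t <- iota 0 (size P)].
    have /(_ rs) := max_poly_roots P0; rewrite size_map size_iota ltnn => H.
    suff : false by []; apply: H.
      apply/allP => _ /mapP[t _ ->]; rewrite /root; apply/negPn/negP => Pt.
      by apply: noroot; exists t.
    rewrite map_inj_uniq ?iota_uniq //.
    exact: (char0_nat_inj (mpolyC n (R:=F))).
  exists (fun j => if j == i then t%:R else b j); apply: contraNneq Pt => Q0.
  rewrite PE -[X in _ == X]Q0; apply/eqP/eq_mmap => // j; rewrite /pt inE.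
  by case: eqP => //= _; rewrite rmorph_nat.
move=> Hb; exists b; apply: contraNneq Hb => Q0.
have -> : mmap (mpolyC n (R:=F)) (pt (enum 'I_n) b) q = mpolyC n (meval b q).
  rewrite /meval mmap_rmorph; apply: eq_mmap => // i.
  by rewrite /pt mem_enum.
by rewrite Q0 mpolyC0.
Qed.

End MpolyPoints.

Section FractionMap.
Variables (R : idomainType) (f : {rmorphism R -> R}) (f_inj : injective f).
Notation Q := {fraction R}.
Notation "x %:F" := (@FracField.tofrac R x).

Lemma repr_numden (x : Q) : x = (\n_(repr x))%:F / (\d_(repr x))%:F.
Proof.
rewrite -[x in LHS]reprK -[repr x in LHS]FracField.Ratio_numden; unlock FracField.tofrac.
rewrite -[_^-1]FracField.pi_inv -[RHS]FracField.pi_mul.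
rewrite /FracField.mulf /FracField.invf !numden_Ratio ?oner_neq0 ?denom_ratioP //.
by rewrite mulr1 mul1r.
Qed.

Lemma fractionP (x : Q) : exists n d, d != 0 /\ x = n%:F / d%:F.
Proof.
by exists \n_(repr x), \d_(repr x); split; [apply: denom_ratioP|apply: repr_numden].
Qed.

Definition fraction_map (x : Q) : Q := (f \n_(repr x))%:F / (f \d_(repr x))%:F.

Lemma fraction_mapE n d : d != 0 -> fraction_map (n%:F / d%:F) = (f n)%:F / (f d)%:F.
Proof.
move=> d0; rewrite /fraction_map; set x := n%:F / d%:F.
have e0 := denom_ratioP (repr x).
have fnz c : c != 0 -> (f c)%:F != 0.
  by rewrite tofrac_eq0 -(inj_eq f_inj) rmorph0.
have tnz c : c != 0 -> c%:F != 0 by rewrite tofrac_eq0.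
apply/eqP; rewrite eqr_div ?fnz // -!tofracM tofrac_eq -!rmorphM inj_eq //.
by rewrite -tofrac_eq !tofracM -eqr_div ?tnz // -repr_numden.
Qed.

Lemma fraction_map_tofrac a : fraction_map a%:F = (f a)%:F.
Proof. by rewrite -[a%:F]divr1 -tofrac1 fraction_mapE ?oner_neq0 // rmorph1 tofrac1 divr1. Qed.

Let nz c : c != 0 -> c%:F != 0. Proof. by rewrite tofrac_eq0. Qed.
Let fnz c : c != 0 -> (f c)%:F != 0.
Proof. by rewrite tofrac_eq0 -(inj_eq f_inj) rmorph0. Qed.

Fact fraction_map_zmod : zmod_morphism fraction_map.
Proof.
move=> x y; have [n [d [d0 ->]]] := fractionP x; have [k [e [e0 ->]]] := fractionP y.
rewrite !fraction_mapE // -mulNr addf_div ?nz // -tofracN -!tofracM -tofracD.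
rewrite fraction_mapE ?mulf_neq0 // rmorphD !rmorphM rmorphN.
by rewrite tofracD !tofracM -addf_div ?fnz // tofracN mulNr.
Qed.

Fact fraction_map_monoid : monoid_morphism fraction_map.
Proof.
split; first by rewrite -tofrac1 fraction_map_tofrac rmorph1.
move=> x y; have [n [d [d0 ->]]] := fractionP x; have [k [e [e0 ->]]] := fractionP y.
rewrite !fraction_mapE // mulf_div -!tofracM fraction_mapE ?mulf_neq0 //.
by rewrite !rmorphM mulf_div.
Qed.

Definition fraction_rmorphism : {rmorphism Q -> Q} :=
  HB.pack_for {rmorphism Q -> Q} fraction_map
    (GRing.isZmodMorphism.Build Q Q fraction_map fraction_map_zmod)
    (GRing.isMonoidMorphism.Build Q Q fraction_map fraction_map_monoid).

Lemma iter_fraction_map t n d : d != 0 ->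
  iter t fraction_map (n%:F / d%:F) = (iter t f n)%:F / (iter t f d)%:F.
Proof.
move=> d0; elim: t => //= t ->; rewrite fraction_mapE //.
by elim: t => //= t; rewrite -(inj_eq f_inj) rmorph0.
Qed.

End FractionMap.

(** * Twisted-stable subspaces *)

(** Here [P] lists the powers of a matrix whose [M]-th power is the scalar [t].
    Iterating [sigma V *m P 1 = L *m V] up to that power exhibits [t ^+ \rank V]
    as the norm of the determinant of [L]. *)
Lemma twisted_rank (K : fieldType) (sigma : {rmorphism K -> K}) (M : nat) (t : K)
    n (P : nat -> 'M[K]_n) k (V : 'M[K]_(k, n)) :
    (forall x, iter M sigma x = x) ->
    (forall l x, t ^+ l = \prod_(i < M) iter i sigma x -> (M %| l)%N) ->
    P 0%N = 1%:M -> (forall s, P s.+1 = P s *m P 1%N) ->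
    (forall s, map_mx sigma (P s) = P s) -> P M = t%:M ->
    (map_mx sigma V *m P 1%N <= V)%MS ->
  (M %| \rank V)%N.
Proof.
move=> sigmaM norm P0 PS Pfix PM stableV.
set W := row_base V; have eqWV : (W :=: V)%MS := eq_row_base V.
have /submxP[L LE] : (map_mx sigma W *m P 1%N <= W)%MS.
  rewrite eqWV; apply: submx_trans stableV; apply: submxMr.
  by rewrite map_submx eqWV.
have [D [DE detD]] : exists D, map_mx (iter M sigma) W *m P M = D *m W /\
    \det D = \prod_(i < M) iter i sigma (\det L).
  elim: M {sigmaM norm PM} => [|s [D [DE detD]]].
    exists 1%:M; rewrite P0 mulmx1 mul1mx det1 big_ord0; split=> //.
    by apply/matrixP => i j; rewrite mxE.
  exists (map_mx sigma D *m L); split.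
    have -> : map_mx (iter s.+1 sigma) W = map_mx sigma (map_mx (iter s sigma) W).
      by apply/matrixP => i j; rewrite !mxE.
    by rewrite PS mulmxA -{1}(Pfix s) -map_mxM DE map_mxM -mulmxA LE mulmxA.
  rewrite det_mulmx det_map_mx detD rmorph_prod big_ord_recl /= mulrC.
  by congr (_ * _).
apply: norm (\det L) _; rewrite -detD -det_scalar; congr (\det _).
apply: (row_free_inj (row_base_free V)).
rewrite -[RHS]/(D *m W) -DE PM mul_mx_scalar -/W mul_scalar_mx; congr (_ *: _).
by apply/matrixP => i j; rewrite [RHS]mxE sigmaM.
Qed.

(** The norm of a fraction has a degree in the indeterminate that is [M.+1] times
    the degree of the fraction, since [f] preserves degrees. *)
Lemma norm_degree (B : idomainType) (f : {rmorphism {poly B} -> {poly B}})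
    (f_inj : injective f) (M : nat) :
    (forall p, size (f p) = size p) ->
  forall l (x : {fraction {poly B}}),
    (FracField.tofrac 'X) ^+ l =
      \prod_(i < M.+1) iter i (fraction_rmorphism f_inj) x ->
  (M.+1 %| l)%N.
Proof.
move=> fsize l x; have [n [d [d0 ->]]] := fractionP x.
have iter0 c i : c != 0 -> iter i f c != 0.
  by move=> c0; elim: i => //= i; rewrite -(inj_eq f_inj) rmorph0.
have norm0 c : c != 0 -> \prod_(i < M.+1) iter i f c != 0.
  by move=> c0; apply/prodf_neq0 => i _; apply: iter0.
have deg c : c != 0 -> (size (\prod_(i < M.+1) iter i f c)).-1 = (M.+1 * (size c).-1)%N.
  move=> c0; rewrite size_prod => [|i _]; last exact: iter0.
  rewrite (eq_bigr (fun=> size c)); last first.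
    by move=> i _; elim: (val i) => //= j <-.
  rewrite sum_nat_const card_ord; have := c0; rewrite -size_poly_gt0.
  by case: (size c) => // e _; rewrite mulnS subSn ?leq_addr // addKn.
under eq_bigr do rewrite [iter _ _ _]iter_fraction_map //.
rewrite prodf_div -!rmorph_prod -rmorphXn => E.
have {E} : 'X ^+ l * \prod_(i < M.+1) iter i f d = \prod_(i < M.+1) iter i f n.
  by apply/eqP; rewrite -tofrac_eq rmorphM /= E divfK // tofrac_eq0 norm0.
have [->|n0] := eqVneq n 0.
  rewrite [RHS](bigD1 ord0) //= mul0r => /eqP.
  by rewrite mulf_eq0 expf_eq0 polyX_eq0 andbF (negbTE (norm0 d d0)).
move/(congr1 (fun p : {poly B} => (size p).-1)).
rewrite deg // mulrC size_mulXn ?norm0 //.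
have := deg d d0; have := norm0 d d0; rewrite -size_poly_gt0.
case: (size _) => // e _ /= ->; rewrite addnS /= => E.
by rewrite -(dvdn_addl _ (dvdn_mulr (size d).-1 (dvdnn M.+1))) E dvdn_mulr.
Qed.

Section Twist.
Variables (K : fieldType) (m : nat).
Notation A := 'M[K]_m.+1.
Variables (sigma : {rmorphism K -> K}) (C : A).
Hypothesis Cunit : C \is a GRing.unit.

Definition twist p q (X : 'M[A]_(p, q)) : 'M[A]_(p, q) := map_mx (map_mx sigma) X.

Definition twist_mx (X : A) : A := C^-1 * map_mx sigma X * C.

Lemma twist_mx_id X : map_mx sigma X * C = C * X -> twist_mx X = X.
Proof. by move=> XC; rewrite /twist_mx -mulrA XC mulKr. Qed.

Fact twist_mx_zmod : zmod_morphism twist_mx.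
Proof. by move=> X Y; rewrite /twist_mx map_mxB mulrBr mulrBl. Qed.

Fact twist_mx_monoid : monoid_morphism twist_mx.
Proof.
split=> [|X Y]; first by rewrite /twist_mx map_mx1 mulr1 mulVr.
by rewrite /twist_mx map_mxM !mulrA mulrK.
Qed.

Definition twist_rmorphism : {rmorphism A -> A} :=
  HB.pack_for {rmorphism A -> A} twist_mx
    (GRing.isZmodMorphism.Build _ _ twist_mx twist_mx_zmod)
    (GRing.isMonoidMorphism.Build _ _ twist_mx twist_mx_monoid).

Lemma twist_fixed p q (X : 'M[A]_(p, q)) : map_mx twist_rmorphism X = X ->
  twist X *m C%:M = C%:M *m X.
Proof.
move=> XE; apply/matrixP => i j.
have /matrixP/(_ i j) := XE; rewrite mxE /= /twist_mx => XijE.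
rewrite mul_scalar_mx [RHS]mxE -XijE.
rewrite [LHS]mxE (bigD1 j) //= big1 ?addr0 => [|h hj]; last first.
  by rewrite [X in _ * X]mxE (negbTE hj) mulr0n mulr0.
rewrite [X in _ * X]mxE eqxx mulr1n [X in X * _]mxE.
by rewrite !mulrA divrr // mul1r.
Qed.

End Twist.

Section TwistedSystem.
Variables (K : fieldType) (m g n : nat).
Notation M := m.+1.
Notation A := 'M[K]_M.
Variables (sigma : {rmorphism K -> K}) (t : K) (C : A) (S : sys 'I_g A n).
Hypothesis sigmaM : forall x, iter M sigma x = x.
Hypothesis norm : forall l x, t ^+ l = \prod_(i < M) iter i sigma x -> (M %| l)%N.
Hypothesis CM : C ^+ M = t%:M.
Hypothesis Cunit : C \is a GRing.unit.
Hypothesis Cfix : map_mx sigma C = C.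

Notation twist := (twist sigma).

Hypothesis twist_c : twist (sc S) *m C%:M = C%:M *m sc S.
Hypothesis twist_N : forall x, twist (sN S x) *m C%:M = C%:M *m sN S x.
Hypothesis twist_b : twist (sb S) *m C%:M = C%:M *m sb S.

Lemma twistM p q r (X : 'M[A]_(p, q)) (Y : 'M[A]_(q, r)) :
  twist (X *m Y) = twist X *m twist Y.
Proof. by rewrite /twist map_mxM. Qed.

Lemma flat_twist p q (X : 'M[A]_(p, q)) : flat (twist X) = map_mx sigma (flat X).
Proof. by apply: flatP => i j k l; rewrite [RHS]mxE !flatE !mxE. Qed.

Lemma flat_scalar (a : K) : flat (a%:M%:M : 'M[A]_n) = a%:M.
Proof.
rewrite -[RHS]scalemx1 -(flat1 K m n); apply: flatP => i j k l.
rewrite [RHS]mxE !flatE !mxE; case: (i == j); rewrite ?mulr1n ?mulr0n !mxE ?mulr0 //.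
by rewrite mulr_natr.
Qed.

Lemma stable_rank k (V : 'M[K]_(k, n * M)) :
  (map_mx sigma V *m flat (C%:M : 'M[A]_n) <= V)%MS -> (M %| \rank V)%N.
Proof.
rewrite -[C in C%:M]expr1.
apply: (@twisted_rank K sigma M t _ (fun s => flat ((C ^+ s)%:M : 'M[A]_n))) => //.
- by rewrite expr0 flat1.
- by move=> s; rewrite expr1 -flatM -scalar_mxM -exprSr.
- by move=> s; rewrite -flat_twist /twist map_scalar_mx /= rmorphXn /= Cfix.
by rewrite CM flat_scalar.
Qed.

(** The twist does not permute the matrix units, so that it acts only on words
    whose letters carry arbitrary coefficients.  The letters depend linearly on
    their coefficients, hence the row spaces computed with the words of [full]
    and of [units] agree. *)
Definition full : sys (A * 'I_g) A n := pull id S.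
Definition units : sys ('I_g * ('I_M * 'I_M)) A n := pull (@unit_letter K m g) S.

Definition conj_letter (w : A * 'I_g) : A * 'I_g := (twist_mx sigma C w.1, w.2).

Lemma conj_letter_surj w : exists w', map conj_letter w' = w.
Proof.
elim: w => [|[e x] w [w' <-]]; first by exists [::].
exists ((map_mx (iter m sigma) (C * e * C^-1), x) :: w') => /=.
rewrite /conj_letter /twist_mx /=; congr (_ :: _); congr (_, x).
have -> : map_mx sigma (map_mx (iter m sigma) (C * e * C^-1)) = C * e * C^-1.
  by apply/matrixP => i j; rewrite !mxE [LHS]sigmaM.
by rewrite !mulrA mulVr // mul1r mulrVK.
Qed.

Lemma twist_word w :
  twist (wordmx (sN full) w) *m C%:M = C%:M *m wordmx (sN full) (map conj_letter w).
Proof.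
elim: w => [|[e x] w IH] /=; first by rewrite /twist map_mx1 mul1mx mulmx1.
rewrite twistM -mulmxA IH !mulmxA; congr (_ *m _).
rewrite /twist map_mxZ -scalemxAl -/(twist _) twist_N -!mul_scalar_mx !mulmxA.
rewrite -!scalar_mxM; congr (_%:M *m _).
by rewrite /twist_mx !mulrA divrr // mul1r.
Qed.

Lemma flat_letter_sum p q (e : A) (X : 'M[A]_(p, q)) :
  flat (e *: X) = \sum_i \sum_j e i j *: flat (delta_mx i j *: X).
Proof.
apply: flatP => a b k l; rewrite flatE [in LHS]mxE {1}[e]matrix_sum_delta.
rewrite mulr_suml !summxE; apply: eq_bigr => i _.
rewrite mulr_suml !summxE; apply: eq_bigr => j _.
by rewrite -scalerAl [LHS]mxE [RHS]mxE flatE [in RHS]mxE.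
Qed.

Lemma full_unctr h p (u : 'M[A]_(p, n)) : ctr_rank units h ->
  unctr units u -> unctr full u.
Proof.
move=> ctrh; have [[q [ws rkh]] _] := ctrh => uU w; elim: w p u uU => [|[e x] w IH] p u uU.
  exact: (uU [::]).
rewrite [wordmx _ _]/= mulmxA; apply: IH; apply/(unctrP _ ctrh rkh).
rewrite flatM /= flat_letter_sum mulmx_sumr mulmx_suml big1 // => i _.
rewrite mulmx_sumr mulmx_suml big1 // => j _.
rewrite -scalemxAr -scalemxAl -flatM (unctrP _ ctrh rkh).2 ?scaler0 // => v.
by rewrite -(mulmxA u); apply: (uU ((x, (i, j)) :: v)).
Qed.

Lemma flat_rows_submx p q r (X : 'M[A]_(p, q)) (Y : 'M[A]_(r, q)) :
  (forall i, (flat (row i X) <= flat Y)%MS) -> (flat X <= flat Y)%MS.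
Proof.
move=> rowX; apply/row_subP => a; case/mxvec_indexP: a => i k.
apply: submx_trans (rowX i).
have -> : row (mxvec_index i k) (flat X) = row (mxvec_index 0 k) (flat (row i X)).
  apply/rowP => b; case/mxvec_indexP: b => j l.
  by rewrite !mxE !mxvec_indexK.
exact: row_sub.
Qed.

Lemma obsmx_submx T (S' : sys T A n) h q (us : 'I_q -> seq T) q' (us' : 'I_q' -> seq T) :
    obs_rank S' h -> \rank (flat (obsmx S' us)) = h ->
  (flat (obsmx S' us') <= flat (obsmx S' us))%MS.
Proof.
move=> obsh rkh; apply: flat_rows_submx => i; rewrite row_obsmx.
exact: obs_absorb obsh rkh.
Qed.

Lemma full_obs h q (us : 'I_q -> _) w :
    obs_rank units h -> \rank (flat (obsmx units us)) = h ->
  (flat (sc S *m wordmx (sN full) w) <= flat (obsmx units us))%MS.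
Proof.
move=> obsh rkh; elim/last_ind: w => [|w [e x] IH].
  by have := obs_absorb [::] obsh rkh.
rewrite wordmx_rcons mulmxA flatM /= flat_letter_sum.
apply: submx_trans (submxMr _ IH) _; rewrite mulmx_sumr summx_sub // => i _.
rewrite mulmx_sumr summx_sub // => j _; rewrite -scalemxAr scalemx_sub // -flatM.
rewrite (_ : _ *m _ = obsmx units (fun k => rcons (us k) (x, (i, j)))).
  exact: obsmx_submx obsh rkh.
by apply/row_matrixP => k; rewrite row_mul !row_obsmx wordmx_rcons mulmxA.
Qed.

(** The uncontrollable rows and the row span of the observability matrix are
    stable under the twist that fixes the system, hence so is their
    intersection, which measures the defect of the Hankel rank. *)
Lemma twisted_ctr_stable h q (ws : 'I_q -> _) :
    ctr_rank units h -> \rank (flat (ctrmx units ws)) = h ->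
  (map_mx sigma (kermx (flat (ctrmx units ws))) *m flat (C%:M : 'M[A]_n) <=
   kermx (flat (ctrmx units ws)))%MS.
Proof.
set W := kermx _ => ctrh rkh; apply/sub_kermxP.
rewrite -[W]unflatK -flat_twist -flatM; apply/(unctrP _ ctrh rkh).
have : unctr full (unflat W).
  by apply: full_unctr (ctrh) _; apply/(unctrP _ ctrh rkh); rewrite unflatK mulmx_ker.
move=> uncW; have uncC : unctr full (twist (unflat W) *m C%:M).
  move=> w; have [w' <-] := conj_letter_surj w.
  rewrite -(mulmxA (twist _)) -twist_word mulmxA -twistM -mulmxA -twist_b mulmxA.
  by rewrite -twistM uncW /twist map_mx0 mul0mx.
move=> w; rewrite -(uncC (map (@unit_letter K m g) w)); congr (_ *m _ *m _).
by elim: w => //= a w ->.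
Qed.

Lemma twisted_obs_stable h q (us : 'I_q -> _) :
    obs_rank units h -> \rank (flat (obsmx units us)) = h ->
  (map_mx sigma (flat (obsmx units us)) *m flat (C%:M : 'M[A]_n) <=
   flat (obsmx units us))%MS.
Proof.
move=> obsh rkh; rewrite -flat_twist -flatM; apply: flat_rows_submx => i.
rewrite row_mul /twist -map_row row_obsmx -/(twist _).
rewrite (_ : wordmx _ _ = wordmx (sN full) (map (@unit_letter K m g) (us i))); last first.
  by elim: (us i) => //= a w ->.
rewrite twistM -mulmxA twist_word mulmxA twist_c -mulmxA flatM.
exact: submx_trans (submxMl _ _) (full_obs _ obsh rkh).
Qed.

Lemma twisted_ctr_rank h : ctr_rank units h -> (M %| h)%N.
Proof.
move=> ctrh; have [[q [ws rkh]] _] := ctrh.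
have := stable_rank (twisted_ctr_stable ctrh rkh).
rewrite mxrank_ker rkh => dv.
have le_h : (h <= n * M)%N by rewrite -rkh rank_leq_row.
by rewrite -(dvdn_addr _ dv) subnK // dvdn_mull.
Qed.

(** The rank of a product is the rank of its left factor minus the dimension of
    the part of the row span that the right factor kills. *)
Lemma twisted_hankel_rank h : hankel_rank units h -> (M %| h)%N.
Proof.
case=> -[q0 [us0 [q0' [ws0 rk0]]]] maxh.
have [c ctrc] := ctr_rank_exists units; have [[q' [ws rkc]] _] := ctrc.
have [o obso] := obs_rank_exists units; have [[q [us rko]] _] := obso.
set Z := flat (ctrmx units ws); set V := flat (obsmx units us).
have -> : h = \rank (V *m Z).
  apply/eqP; rewrite eqn_leq -flatM maxh andbT -rk0 !flatM.
  have /submxP[D ->] := obsmx_submx us0 obso rko.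
  have kerZ : (kermx Z <= kermx (flat (ctrmx units ws0)))%MS.
    apply/sub_kermxP; rewrite -[kermx Z]unflatK -flatM.
    rewrite (_ : _ *m _ = 0) ?flat0 //.
    have uncK : unctr units (unflat (kermx Z)).
      by apply/(unctrP _ ctrc rkc); rewrite unflatK mulmx_ker.
    apply/matrixP => i j.
    have -> : (unflat (kermx Z) *m ctrmx units ws0) i j =
        (unflat (kermx Z) *m col j (ctrmx units ws0)) i 0.
      by rewrite colE mulmxA -colE [RHS]mxE.
    by rewrite col_ctrmx mulmxA uncK !mxE.
  have /eqP := mxrank_mul_ker V Z; have /eqP := mxrank_mul_ker V (flat (ctrmx units ws0)).
  rewrite -mulmxA => /eqP E0 /eqP E1.
  apply: leq_trans (mxrankM_maxr _ _) _.
  rewrite -(leq_add2r (\rank (V :&: kermx Z))) E1 -E0 leq_add2l.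
  by apply: mxrankS; apply: capmxS.
have stab : (map_mx sigma (V :&: kermx Z)%MS *m flat (C%:M : 'M[A]_n) <=
    V :&: kermx Z)%MS.
  rewrite sub_capmx; apply/andP; split.
    apply: submx_trans (twisted_obs_stable obso rko); apply: submxMr.
    by rewrite map_submx capmxSl.
  apply: submx_trans (twisted_ctr_stable ctrc rkc); apply: submxMr.
  by rewrite map_submx capmxSr.
have := stable_rank (twisted_obs_stable obso rko); rewrite -/V.
by rewrite -(mxrank_mul_ker V Z) dvdn_addl // stable_rank.
Qed.

End TwistedSystem.

(** * A generic point fixed by a twist *)

Section GenericPoint.
Variables (F : fieldType) (m g : nat).
Notation M := m.+1.
Notation A := 'M[F]_M.
Notation N := #|{: 'I_g * ('I_M * 'I_M)}|.
Notation pol := (mpoly.mpoly N F).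
Notation K := {fraction {poly pol}}.
Notation tofrac := (@FracField.tofrac {poly pol}).

Definition shift (i : 'I_M) : 'I_M := inZp 1 + i.
Arguments shift : simpl never.

Lemma iter_shift s i : iter s shift i = inZp s + i.
Proof.
rewrite iter_addr Zp_mulrn; congr (_ + _); apply: val_inj.
by rewrite /= modnMml mul1n.
Qed.

Lemma iter_shiftM i : iter M shift i = i.
Proof.
rewrite iter_shift (_ : inZp M = 0) ?add0r //.
by apply: val_inj; rewrite /= modnn.
Qed.

Lemma shift_val i : shift i = (if i == ord_max then 0 else i.+1) :> nat.
Proof.
rewrite /shift /= modnDml add1n; have [->|im] := eqVneq i ord_max; first by rewrite modnn.
by rewrite modn_small // ltnS ltn_neqAle im -ltnS ltn_ord.
Qed.

Definition shift_index (l : 'I_N) : 'I_N :=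
  let: (k, (i, j)) := enum_val l in enum_rank (k, (shift i, shift j)).

Lemma iter_shift_index s k i j :
  iter s shift_index (enum_rank (k, (i, j))) =
  enum_rank (k, (iter s shift i, iter s shift j)).
Proof. by elim: s => //= s ->; rewrite /shift_index enum_rankK. Qed.

Lemma iter_shift_indexM l : iter M shift_index l = l.
Proof.
by rewrite -[l]enum_valK; case: (enum_val l) => k [i j];
   rewrite iter_shift_index !iter_shiftM.
Qed.

Definition shift_pol : pol -> pol :=
  mmap (mpolyC N (R:=F)) (fun l => mpolyX F (mnm1 (shift_index l))).

HB.instance Definition _ := GRing.RMorphism.on shift_pol.

Lemma iter_shift_pol s q : iter s shift_pol q =
  mmap (mpolyC N (R:=F)) (fun l => mpolyX F (mnm1 (iter s shift_index l))) q.
Proof.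
elim: s q => [|s IH] q; first by rewrite mmap_variables.
rewrite iterS IH /shift_pol mmap_rmorph; apply: eq_mmap => [c|l] /=.
  by rewrite mmapC.
by rewrite mmapX mmap1U.
Qed.

Lemma iter_shift_polM q : iter M shift_pol q = q.
Proof.
rewrite iter_shift_pol -[RHS]mmap_variables; apply: eq_mmap => // l.
by rewrite iter_shift_indexM.
Qed.

Lemma iter_inj (T : Type) (f : T -> T) s : (forall x, iter s.+1 f x = x) -> injective f.
Proof. by move=> fs; apply: (can_inj (g := iter s f)) => x; rewrite -iterSr fs. Qed.

Definition shift_poly : {poly pol} -> {poly pol} := map_poly shift_pol.

HB.instance Definition _ := GRing.RMorphism.on shift_poly.

Lemma iter_shift_polyM p : iter M shift_poly p = p.
Proof.
have coefE s i : (iter s shift_poly p)`_i = iter s shift_pol p`_i.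
  by elim: s => //= s IH; rewrite coef_map IH.
by apply/polyP => i; rewrite coefE iter_shift_polM.
Qed.

Lemma shift_poly_inj : injective shift_poly. Proof. exact: iter_inj iter_shift_polyM. Qed.

Definition sigma : {rmorphism K -> K} := fraction_rmorphism shift_poly_inj.

Lemma sigma_tofrac p : sigma (tofrac p) = tofrac (shift_poly p).
Proof. exact: fraction_map_tofrac shift_poly_inj p. Qed.

Lemma iter_sigmaM x : iter M sigma x = x.
Proof.
have [n [d [d0 ->]]] := fractionP x.
by rewrite [LHS](iter_fraction_map shift_poly_inj) // !iter_shift_polyM.
Qed.

Definition iota : {rmorphism F -> K} := tofrac \o (polyC \o mpolyC N (R:=F)).

Lemma sigma_iota c : sigma (iota c) = iota c.
Proof.
rewrite -[iota c]/(tofrac (mpolyC N c)%:P) sigma_tofrac /shift_poly map_polyC /=.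
by rewrite [shift_pol _]mmapC.
Qed.

Definition indet : K := tofrac 'X.

Lemma sigma_indet : sigma indet = indet.
Proof. by rewrite sigma_tofrac /shift_poly map_polyX. Qed.

Lemma sigma_indetX k : sigma (indet ^+ k) = indet ^+ k.
Proof. by rewrite rmorphXn; congr (_ ^+ k); apply: sigma_indet. Qed.

Lemma indet_norm l x : indet ^+ l = \prod_(i < M) iter i sigma x -> (M %| l)%N.
Proof.
apply: norm_degree => p; apply: size_map_inj_poly; last exact: rmorph0.
exact: iter_inj iter_shift_polM.
Qed.

Definition weight (i : 'I_M) : K := indet ^+ (i == ord_max).

(** The companion matrix of the polynomial [X ^+ M - indet]. *)
Definition cyclic_mx : 'M[K]_M := \matrix_(i, j) ((j == shift i)%:R * weight i).

Lemma cyclic_mxX s i j : (cyclic_mx ^+ s) i j =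
  (j == iter s shift i)%:R * \prod_(h < s) weight (iter h shift i).
Proof.
elim: s i j => [|s IH] i j; first by rewrite expr0 big_ord0 mulr1 mxE eq_sym.
rewrite exprS mxE (bigD1 (shift i)) //= big1 ?addr0 => [|h /negbTE hi]; last first.
  by rewrite mxE hi !mul0r.
rewrite mxE eqxx mul1r IH -iterSr big_ord_recl /= mulrCA; congr (_ * (_ * _)).
by apply: eq_bigr => h _; rewrite -iterSr.
Qed.

Lemma cyclic_mxM : cyclic_mx ^+ M = indet%:M.
Proof.
apply/matrixP => i j; rewrite cyclic_mxX iter_shiftM [RHS]mxE eq_sym -[RHS]mulr_natl.
congr (_ * _); transitivity (\prod_(h < M) weight (h + i)).
  by apply: eq_bigr => h _; rewrite iter_shift valZpK.
transitivity (\prod_(h < M) weight h); first by rewrite [RHS](reindex_inj (addIr i)).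
rewrite (bigD1 ord_max) //= /weight eqxx big1 ?mulr1 // => h /negbTE ->.
by rewrite expr0.
Qed.

Lemma indet_neq0 : indet != 0. Proof. by rewrite tofrac_eq0 polyX_eq0. Qed.

Lemma cyclic_mx_unit : cyclic_mx \is a GRing.unit.
Proof.
rewrite -(unitrX_pos _ (ltn0Sn m)) cyclic_mxM.
apply/unitrP; exists indet^-1%:M.
by rewrite -!mulmxE -!scalar_mxM mulVf ?mulfV ?indet_neq0.
Qed.

Lemma sigma_cyclic_mx : map_mx sigma cyclic_mx = cyclic_mx.
Proof.
by apply/matrixP => i j; rewrite !mxE rmorphM (rmorph_nat sigma) sigma_indetX.
Qed.

(** The powers of [indet] make up for those that conjugation by [cyclic_mx]
    produces when an index wraps around. *)
Definition generic_point : mxpoint K m g := fun k => \matrix_(i, j)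
  (indet ^+ (j < i)%N * tofrac (mpolyX F (mnm1 (enum_rank (k, (i, j)))))%:P).

Lemma generic_point_twist k :
  map_mx sigma (generic_point k) * cyclic_mx = cyclic_mx * generic_point k.
Proof.
have shift_inj : injective shift := @addrI _ (inZp 1).
have sX := sigma_indetX; have sT := sigma_tofrac; move: sigma sX sT => s sX sT.
apply/matrixP => i j'; have [j ->] : exists j, j' = shift j.
  by exists (iter m shift j'); rewrite -iterS iter_shiftM.
have expE : ((j < i) + (j == ord_max) = (i == ord_max) + (shift j < shift i))%N.
  rewrite !shift_val -!val_eqE /=.
  have := ltn_ord i; have := ltn_ord j; rewrite !ltnS => jm im.
  by case: eqP => ?; case: eqP => ?; lia.
have cycE a b : cyclic_mx a (shift b) = if a == b then weight a else 0.
  rewrite mxE (inj_eq shift_inj) eq_sym; case: (a == b); last exact: mul0r.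
  exact: mul1r.
rewrite [LHS]mxE [RHS]mxE (bigD1 j) //= big1 => [|h hj]; last first.
  by rewrite cycE (negbTE hj) mulr0.
rewrite (bigD1 (shift i)) //= big1 => [|h hi]; last first.
  by rewrite [X in X * _]mxE (negbTE hi) !mul0r.
rewrite !addr0 !cycE !eqxx !mxE (rmorphM s) sX sT.
rewrite /shift_poly map_polyC /= /shift_pol mmapX mmap1U /shift_index enum_rankK.
by rewrite /weight mulrAC mulrA -!exprD expE.
Qed.

(** Setting [indet] to 1 turns the generic point into the matrices of the
    variables, so that its entries satisfy no algebraic relation over [F]. *)
Lemma generic_point_eval (q : pol) :
  q != 0 -> mmap iota (pt_coord generic_point) q != 0.
Proof.
pose z (l : 'I_N) : {poly pol} := let: (k, (i, j)) := enum_val l in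
  'X ^+ (j < i)%N * (mpolyX F (mnm1 l))%:P.
have -> : mmap iota (pt_coord generic_point) q = tofrac (mmap (polyC \o mpolyC N (R:=F)) z q).
  rewrite mmap_rmorph; apply: eq_mmap => l //=.
  rewrite /pt_coord /z /= -[l in mnm1 l]enum_valK.
  by case: (enum_val l) => k [i j]; rewrite mxE rmorphM rmorphXn.
rewrite tofrac_eq0; apply: contraNneq => z0.
have := congr1 (horner_eval 1) z0; rewrite rmorph0 mmap_rmorph => <-.
apply/eqP; rewrite -[LHS]mmap_variables; apply: eq_mmap => [c|l] /=.
  by rewrite /horner_eval hornerC.
rewrite /z; case: (enum_val l) => k [i j].
by rewrite /horner_eval hornerM hornerXn expr1n mul1r hornerC.
Qed.

Section Rank.
Variable r : ratexpr F g.
Hypothesis r_def : rat_domain r K iota generic_point.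

Lemma std_generic_fixed :
  map_sys (twist_rmorphism sigma cyclic_mx_unit) (std_at r K iota generic_point) = std_at r K iota generic_point.
Proof.
apply/esym/map_stdsys => // [c|i]; apply: (twist_mx_id cyclic_mx_unit).
  rewrite map_scalar_mx; have -> : sigma (iota c) = iota c by apply: sigma_iota.
  by rewrite -!mulmxE scalar_mxC.
exact: generic_point_twist.
Qed.

Let S := std_at r K iota generic_point.

Let S_fixed_c : map_mx (twist_rmorphism sigma cyclic_mx_unit) (sc S) = sc S.
Proof. exact: (congr1 (fun S' => sc S') std_generic_fixed). Qed.
Let S_fixed_N x : map_mx (twist_rmorphism sigma cyclic_mx_unit) (sN S x) = sN S x.
Proof. exact: (congr1 (fun S' => sN S' x) std_generic_fixed). Qed.
Let S_fixed_b : map_mx (twist_rmorphism sigma cyclic_mx_unit) (sb S) = sb S.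
Proof. exact: (congr1 (fun S' => sb S') std_generic_fixed). Qed.

Lemma generic_ctr_rank h : ctr_rank (pull (@unit_letter K m g) S) h -> (M %| h)%N.
Proof.
apply: (twisted_ctr_rank iter_sigmaM indet_norm cyclic_mxM cyclic_mx_unit
  sigma_cyclic_mx) => [x|]; apply: (twist_fixed (Cunit := cyclic_mx_unit));
  [exact: S_fixed_N|exact: S_fixed_b].
Qed.

Lemma generic_hankel_rank h : hankel_rank (pull (@unit_letter K m g) S) h -> (M %| h)%N.
Proof.
apply: (twisted_hankel_rank iter_sigmaM indet_norm cyclic_mxM cyclic_mx_unit
  sigma_cyclic_mx) => [|x|]; apply: (twist_fixed (Cunit := cyclic_mx_unit));
  [exact: S_fixed_c|exact: S_fixed_N|exact: S_fixed_b].
Qed.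

End Rank.
End GenericPoint.

(** * Totally reduced representations at general points *)

Theorem theorem5p5 (F : fieldType) (charF0 : [pchar F] =i pred0) (m g : nat)
    (r : ratexpr F g) (r_defined : rat_dom m r !=set0) :
  exists O : set (mxpoint F m g),
    [/\ O !=set0, zariski_open O, O `<=` rat_dom m r &
      forall p, O p ->
        exists (k : nat) (R : rep F m g k),
          [/\ represents R (expansion r p), totally_reduced R &
              reduction (projT2 (standard r p)) R]].
Proof.
(* an opaque copy of the identity, which unification cannot unfold *)
have [id0 id0E] : exists id0 : {rmorphism F -> F}, id0 =1 id by exists idfun.
have scalarE : (fun k : F => k%:A : 'M[F]_m.+1) = (fun k : F => (id0 k)%:M).
  by apply/funext => k; rewrite -scalemx1 id0E.
have domE p : rat_dom m r p = rat_domain r F id0 p.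
  by rewrite /rat_dom /rat_domain /= -defined_rat_dom scalarE.
have evalE p q : mmap id0 (pt_coord p) q = meval (pt_coord p) q.
  exact: eq_mmap.
pose K : fieldType := {fraction {poly mpoly.mpoly #|{: 'I_g * ('I_m.+1 * 'I_m.+1)}| F}}.
pose gp : mxpoint K m g := @generic_point F m g; pose io : {rmorphism F -> K} := iota F m g.
have gp_def : rat_domain r K io gp.
  have [del delE] := rat_domain_basic m r; have [p] := r_defined.
  rewrite domE !delE => dp; apply: generic_point_eval.
  by apply: contraNneq dp => ->; rewrite rmorph0.
pose U (K' : fieldType) (i : {rmorphism F -> K'}) p :=
  pull (@unit_letter K' m g) (std_at r K' i p).
have regU := regular_letters m r.
have [h1 ctr1] := ctr_rank_exists (U K io gp).
have [h2 hank2] := hankel_rank_exists (U K io gp).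
have /dvdnP[k1 h1E] := generic_ctr_rank gp_def ctr1.
have /dvdnP[k2 h2E] := generic_hankel_rank gp_def hank2.
have [[n1 [ws1 rk1]] max1] := ctr1.
have [[n2 [us2 [n3 [ws2 rk2]]]] max2] := hank2.
have [q1 [q1_gp q1P]] := rank_semicontinuous
  (regular_flat (regular_ctrmx ws1 regU)) gp_def.
have [q2 [q2_gp q2P]] := rank_semicontinuous
  (regular_flat (regular_mx2M (regular_obsmx us2 regU) (regular_ctrmx ws2 regU))) gp_def.
have le_gp a b (X : family F m g (fun K => 'M[K]_(a, b))) p :
    regular_mx (rat_domain r) X -> rat_domain r F id0 p ->
    (\rank (X F id0 p) <= \rank (X K io gp))%N.
  move=> rX dp; have [q [qp qP]] := rank_semicontinuous rX dp.
  apply: (qP K io gp _).2; apply: generic_point_eval.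
  by apply: contraNneq qp => ->; rewrite rmorph0.
have q12 : q1 * q2 != 0.
  by apply: mulf_neq0; [apply: contraNneq q1_gp|apply: contraNneq q2_gp] => ->;
     rewrite rmorph0.
exists [set p | meval (pt_coord p) (q1 * q2) != 0]; split.
- have [b qb] := nonzero_value charF0 q12.
  exists (fun k => \matrix_(i, j) b (enum_rank (k, (i, j)))) => /=.
  apply: contraNneq qb => <-; apply/eqP/eq_mmap => // l; rewrite /pt_coord.
  rewrite -{1}[l]enum_valK; case: (enum_val l) => k [i j].
  by rewrite mxE.
- exists [set q1 * q2]; apply/seteqP; split=> p /=; first by exists (q1 * q2).
  by case=> q ->.
- move=> p /=; rewrite domE mevalM mulf_eq0 negb_or -!evalE => /andP[q1p _].
  exact: (q1P F id0 p q1p).1.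
move=> p /=; rewrite mevalM mulf_eq0 negb_or -!evalE => /andP[q1p q2p].
have [dp le1] := q1P F id0 p q1p; have [_ le2] := q2P F id0 p q2p.
have dp' : rat_dom m r p by rewrite domE.
have [Rp [-> linR lettersE]] := letters_standard dp'.
have lettersU : letters Rp = U F id0 p.
  rewrite lettersE /U /std_at (congr1 (fun s => stdsys s p r) scalarE).
  reflexivity.
apply: (@reduction_exists _ _ _ _ _ _ k1 k2).
- apply/representsE; split=> // w.
  by rewrite lettersE represents_standard.
- rewrite lettersU -h1E; split=> [|q ws].
    exists n1, ws1; apply/eqP; rewrite eqn_leq -{2}rk1 le1 andbT.
    apply: leq_trans (max1 _ ws1).
    exact: (le_gp _ _ _ _ (regular_flat (regular_ctrmx ws1 regU)) dp).
  apply: leq_trans (max1 _ ws).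
  exact: (le_gp _ _ _ _ (regular_flat (regular_ctrmx ws regU)) dp).
have hank_le q us q' ws : (\rank (flat (@obsmx _ _ _ (U F id0 p) q us *m
    @ctrmx _ _ _ (U F id0 p) q' ws)) <= h2)%N.
  apply: leq_trans (max2 _ us _ ws).
  exact: (le_gp _ _ _ _ (regular_flat (regular_mx2M (regular_obsmx us regU)
    (regular_ctrmx ws regU))) dp).
rewrite lettersU -h2E; split=> //.
by exists n2, us2, n3, ws2; apply/eqP; rewrite eqn_leq hank_le -rk2.
Qed.
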